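(* Let $p\in(2,\infty)$ and let $X$ be a $C^2$ smooth real Banach space with a $1$-unconditional basis, such that $X$ reflects disjointness and the first and second derivatives of the norm on $X$ are uniformly bounded on the unit sphere $S_X$. Then every contractive projection on $\ell_p(X)$ is an averaging operator and its range admits a block basis.
   Context: All Banach spaces are over $\mathbb{R}$. Let $Z$ be a Banach space with norm $\|\cdot\|$ and a $1$-unconditional basis $\{e_i\}$. For $x=\sum_i\alpha_ie_i\in Z$ the support is $s(x)=\{i\colon\alpha_i\ne0\}$; $x$ is simple if $s(x)$ is finite. $Z$ is a Banach lattice for the coordinatewise order; $x,y\in Z$ are disjoint if $|x|\wedge|y|=0$, equivalently $s(x)\cap s(y)=\emptyset$. The dual $Z^*$ is a Banach lattice, and $v^*,w^*\in Z^*$ are disjoint if $|v^*|\wedge|w^*|=0$. $S_Z=\{z\in Z\colon\|z\|=1\}$. $Z$ is $C^2$ smooth if its norm is twice continuously (Fréchet) differentiable on $Z\setminus\{0\}$. Reflects disjointness: for $x,y\in Z$ let $N(\alpha)=\|x+\alpha y\|$, $\alpha\in\mathbb{R}$. $Z$ reflects disjointness if for every $x,y\in Z$ with $x\notin\mathrm{span}\{y\}$: (i) $N$ is continuously differentiable (and then $N''$ exists almost everywhere by convexity); (ii) if $x$ and $y$ are not disjoint and $N'(0)=0$, then $N''(\alpha)$ does not converge to $0$ as $\alpha\to0$ along any subset of $[0,1]$ of full (Lebesgue) measure; (iii) if $x$ and $y$ are disjoint and $y$ is simple, then $N'(0)=0$ and $N''(\alpha)$ converges to $0$ as $\alpha\to0$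 along a subset of $[0,1]$ of full measure. For $X$ with norm $\sigma$ and $1$-unconditional basis $\{e_j\}$, $\ell_p(X)$ is the Banach space of all $x\colon\mathbb{N}\to X$ with $\|x\|=\big(\sum_{k=1}^\infty\sigma(x(k))^p\big)^{1/p}<\infty$. It is equipped with the $1$-unconditional basis $\{e_{ij}\}_{(i,j)}$ (in any ordering), $e_{ij}(k)=e_j$ if $k=i$ and $e_{ij}(k)=0$ otherwise; support, simple, and disjoint in $\ell_p(X)$ refer to this basis. A contractive projection on $Z$ is a linear map $P\colon Z\to Z$ with $P^2=P$ and $\|P\|\le1$. A linear operator $T\colon Z\to Z$ is an averaging operator if there are mutually disjoint elements $\{u_i\}_{i\in I}$ in $Z$ and mutually disjoint elements $\{v_i^*\}_{i\in I}$ in $Z^*$ with $v_i^*(u_j)=0$ for all $i\ne j$ and $Tx=\sum_{i\in I}v_i^*(x)u_i$ for all $x\in Z$. A block basis of a subspace $Y$ is a basis $\{y_i\}_{i=1}^{\dim Y}$ of $Y$ with $y_i$, $y_j$ disjoint for all $i\neq j$. *)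

(* Defs.v *)
From HB Require Import structures.
From mathcomp Require Import all_boot all_order all_algebra.
From mathcomp Require Import finmap.
From mathcomp Require Import all_classical all_reals all_analysis.
From mathcomp.analysis Require Import summability.

Set Implicit Arguments.
Unset Strict Implicit.
Unset Printing Implicit Defensive.

Import Order.TTheory GRing.Theory Num.Theory.
Import numFieldNormedType.Exports.

Local Open Scope classical_set_scope.
Local Open Scope ring_scope.

Section bounded_operators.
Context {R : realType} (V W : normedModType R).

Definition bop_pred : {pred V -> W} := [pred f |
  `[< linear f /\ exists M : R, forall x, `|f x| <= M * `|x| >]].

Lemma bop_submod_closed : submod_closed bop_pred.
Proof.
split.
  apply/asboolP; split.
    by move=> a x y; rewrite /= scaler0 addr0.
  by exists 0 => x; rewrite mul0r normr0.
move=> a f g /asboolP[lf [M fM]] /asboolP[lg [K gK]].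
apply/asboolP; split.
  move=> b x y; change (a *: f (b *: x + y) + g (b *: x + y) =
    b *: (a *: f x + g x) + (a *: f y + g y)).
  by rewrite lf lg !scalerDr !scalerA (mulrC a b) addrACA.
exists (`|a| * M + K) => x.
rewrite mulrDl (le_trans (ler_normD _ _))// lerD// normrZ -mulrA.
by rewrite ler_wpM2l.
Qed.

HB.instance Definition _ := GRing.isSubmodClosed.Build R (V -> W) bop_pred
  bop_submod_closed.

Record bop := Bop { bop_fun :> V -> W ; _ : bop_fun \in bop_pred }.

HB.instance Definition _ := [isSub for bop_fun].
HB.instance Definition _ := [Choice of bop by <:].
HB.instance Definition _ := [SubChoice_isSubLmodule of bop by <:].

Definition opnorm (f : bop) : R := sup [set `|f x| | x in [set x | `|x| <= 1]].

Lemma bopP (f : bop) :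
  linear f /\ exists M : R, forall x, `|f x| <= M * `|x|.
Proof. by case: f => f /= /asboolP. Qed.

Lemma bopZ (f : bop) a x : f (a *: x) = a *: f x.
Proof.
have [lf _] := bopP f.
have f0 : f 0 = 0.
  have := lf 1 0 0; rewrite scaler0 addr0 scale1r => /eqP.
  by rewrite eq_sym -subr_eq0 addrK => /eqP.
by rewrite -[a *: x]addr0 lf f0 addr0.
Qed.

Lemma opnorm_has_sup (f : bop) :
  has_sup [set `|f x| | x in [set x | `|x| <= 1]].
Proof.
have [lf [M fM]] := bopP f; split.
  by exists `|f 0|, 0 => //=; rewrite normr0.
exists `|M| => _ [x /= x1 <-].
rewrite (le_trans (fM x))// (le_trans (ler_norm _))// normrM normr_id.
by rewrite ler_piMr.
Qed.

Lemma opnorm_ge (f : bop) x : `|f x| <= opnorm f * `|x|.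
Proof.
have [->|x0] := eqVneq x 0.
  have /= := bopZ f 0 0; rewrite !scale0r => ->.
  by rewrite !normr0 mulr0.
have nx0 : 0 < `|x| by rewrite normr_gt0.
rewrite -ler_pdivrMr//.
have -> : `|f x| / `|x| = `|f (`|x|^-1 *: x)|.
  by rewrite bopZ normrZ normfV normr_id mulrC.
apply: (sup_upper_bound (opnorm_has_sup f)); exists (`|x|^-1 *: x) => //=.
by rewrite normrZ normfV normr_id mulVf// normr_eq0.
Qed.

Lemma opnorm_le (f : bop) M : (forall x, `|x| <= 1 -> `|f x| <= M) ->
  opnorm f <= M.
Proof.
move=> fM; apply: ge_sup; first by case: (opnorm_has_sup f).
by move=> _ [x x1 <-]; exact: fM.
Qed.

Lemma opnorm_ub (f : bop) x : `|x| <= 1 -> `|f x| <= opnorm f.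
Proof. by move=> x1; apply: (sup_upper_bound (opnorm_has_sup f)); exists x. Qed.

Lemma opnormD (f g : bop) : opnorm (f + g) <= opnorm f + opnorm g.
Proof.
apply: opnorm_le => x x1.
by rewrite (le_trans (ler_normD (f x) (g x)))// lerD// opnorm_ub.
Qed.

Lemma opnormZ a (f : bop) : opnorm (a *: f) = `|a| * opnorm f.
Proof.
have le b (g : bop) : opnorm (b *: g) <= `|b| * opnorm g.
  apply: opnorm_le => x x1.
  by rewrite [(b *: g) x]/(b *: g x) normrZ ler_wpM2l// opnorm_ub.
apply/eqP; rewrite eq_le le/=.
have [->|a0] := eqVneq a 0.
  rewrite normr0 mul0r (le_trans _ (opnorm_ub (0 *: f) (x := 0) _))//.
  by rewrite normr0.
rewrite -ler_pdivlMl ?normr_gt0// -normfV.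
by rewrite -{1}[f]scale1r -(mulVf a0) -scalerA le.
Qed.

Lemma opnorm_eq0 (f : bop) : opnorm f = 0 -> f = 0.
Proof.
move=> f0; apply/val_inj/funext => x; apply/eqP.
by rewrite -normr_eq0 eq_le normr_ge0 andbT (le_trans (opnorm_ge f x))// f0 mul0r.
Qed.

HB.instance Definition _ := Lmodule_isNormed.Build R bop
  opnormD opnormZ opnorm_eq0.

End bounded_operators.

(* The Frechet derivative as a bounded operator; the default value 0 is
   only taken where f is not differentiable *)

Definition Dop {R : realType} {V W : normedModType R} (f : V -> W) (x : V)
  : bop V W := insubd (0 : bop V W) ('d f x : V -> W).

Lemma DopE {R : realType} {V W : normedModType R} (f : V -> W) (x : V) :
  differentiable f x -> Dop f x = 'd f x :> (V -> W).
Proof.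
move=> df; rewrite /Dop val_insubd; case: ifPn => // /negP[].
apply/asboolP; split; first exact: linearP.
have /linear_bounded_continuous/linear_boundedP := diff_continuous df.
by move=> /pinfty_ex_gt0[M _ dfM]; exists M.
Qed.

Definition normf {R : realType} (X : normedModType R) (x : X) : R := `|x|.

Definition C2_smooth {R : realType} (X : normedModType R) :=
  forall x : X, x != 0 ->
    [/\ differentiable (@normf R X) x,
        differentiable (Dop (@normf R X)) x &
        {for x, continuous (Dop (Dop (@normf R X)))}].

Definition norm_derivatives_bounded_on_sphere {R : realType}
    (X : normedModType R) :=
  exists M : R, forall x : X, `|x| = 1 ->
    `|Dop (@normf R X) x| <= M /\ `|Dop (Dop (@normf R X)) x| <= M.

Section bases.
Context {R : realType} {I : countType} {Z : normedModType R}.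
Variable e : I -> Z.
Implicit Types (x y z : Z) (a b : I -> R).

(* unconditional convergence: along the finite subsets of I *)
Definition has_expansion a z :=
  partial_sum (fun i => a i *: e i) @ totally --> z.

Definition unconditional_basis := forall z, exists! a, has_expansion a z.

(* unconditionality constant 1: changes of signs do not increase the norm *)
Definition one_unconditional_basis := unconditional_basis /\
  forall (F : {fset I}) a (s : I -> bool),
    `|\sum_(i <- F) ((-1) ^+ s i * a i) *: e i| <= `|\sum_(i <- F) a i *: e i|.

(* well defined when e is an unconditional basis; the default is otherwise
   irrelevant *)
Definition coord z : I -> R := xget (fun=> 0) [set a | has_expansion a z].

Definition support z : set I := [set i | coord z i != 0].

Definition simple z := finite_set (support z).

Definition coord_le x y := forall i, coord x i <= coord y i.

Definition dual_le (v w : bop Z R^o) :=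
  forall z, coord_le 0 z -> v z <= w z.

End bases.

Section lattice_disjointness.
Context {V : zmodType} (le : V -> V -> Prop).

Definition is_join (x y z : V) :=
  [/\ le x z, le y z & forall w, le x w -> le y w -> le z w].

Definition is_meet (x y z : V) :=
  [/\ le z x, le z y & forall w, le w x -> le w y -> le w z].

(* |x| /\ |y| = 0, with |x| the join of x and -x *)
Definition lattice_disjoint (x y : V) := exists mx my,
  [/\ is_join x (- x) mx, is_join y (- y) my & is_meet mx my 0].

End lattice_disjointness.

Definition disjoint_in {R : realType} {I : countType} {Z : normedModType R}
  (e : I -> Z) : Z -> Z -> Prop := lattice_disjoint (coord_le e).

Definition dual_disjoint {R : realType} {I : countType} {Z : normedModType R}
  (e : I -> Z) : bop Z R^o -> bop Z R^o -> Prop := lattice_disjoint (dual_le e).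

(* A need only be Lebesgue measurable; negligible sets are those contained in
   a Borel null set *)
Definition full_measure_in01 {R : realType} (A : set R) :=
  A `<=` `[0, 1] /\ (@lebesgue_measure R).-negligible (`[0, 1] `\` A).

(* N'' is required to exist on A, since derive1 is total *)
Definition snd_derivative_vanishes_along {R : realType} (N : R -> R)
    (A : set R) :=
  (forall t, A t -> derivable (derive1 N) t 1) /\
  derive1 (derive1 N) @ within A 0^' --> (0 : R).

Definition reflects_disjointness {R : realType} {I : countType}
    {Z : normedModType R} (e : I -> Z) :=
  forall x y : Z, ~ (exists c : R, x = c *: y) ->
  let N := fun t : R => `|x + t *: y| in
  [/\ (forall t, derivable N t 1) /\ continuous (derive1 N),
      ~ disjoint_in e x y -> derive1 N 0 = 0 ->
        forall A, full_measure_in01 A -> ~ snd_derivative_vanishes_along N A &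
      disjoint_in e x y -> simple e y ->
        derive1 N 0 = 0 /\
        exists2 A, full_measure_in01 A & snd_derivative_vanishes_along N A].

Section lp.
Context {R : realType}.
Variables (p : R) (p1 : 1 <= p) (X : normedModType R).

Definition lp_sum (x : nat -> X) : \bar R :=
  (\sum_(0 <= k <oo) (`|x k| `^ p)%:E)%E.

Definition lp_pred of 1 <= p : {pred nat -> X} :=
  [pred x | `[< (lp_sum x < +oo)%E >]].

Definition lp_normf (x : nat -> X) : R := (fine (lp_sum x)) `^ p^-1.

Let p_gt0 : 0 < p. Proof. exact: lt_le_trans ltr01 p1. Qed.

Lemma lp_sum_ge0 x : (0 <= lp_sum x)%E.
Proof. by apply: nneseries_ge0 => k _ _; rewrite lee_fin powR_ge0. Qed.

Lemma lp_sum_Lnorm (x : nat -> X) :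
  ('N[counting]_p%:E [EFin \o (fun k => `|x k|%R)] = lp_sum x `^ p^-1)%E.
Proof.
rewrite (Lnorm_counting _ p_gt0); congr (_ `^ _)%E.
by apply: eq_eseriesr => k _ /=; rewrite normr_id.
Qed.

Lemma lp_sum_le x y : (forall k, `|x k| <= `|y k|) -> (lp_sum x <= lp_sum y)%E.
Proof.
move=> xy; apply: lee_nneseries => [k _ _|k _].
  by rewrite lee_fin powR_ge0.
by rewrite lee_fin ge0_ler_powR// ?nnegrE// ltW.
Qed.

Lemma lp_sum_powlty x : ((lp_sum x `^ p^-1)%E < +oo)%E = (lp_sum x < +oo)%E.
Proof.
apply/idP/idP => h; last exact: poweR_lty.
by apply: lty_poweRy h; rewrite gt_eqF// invr_gt0.
Qed.

Lemma lp_normD_ereal (x y : nat -> X) :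
  (lp_sum (x + y)%R `^ p^-1 <= lp_sum x `^ p^-1 + lp_sum y `^ p^-1)%E.
Proof.
rewrite -!lp_sum_Lnorm.
apply: le_trans; last by apply: minkowski_EFin.
have -> : ('N[counting]_p%:E[EFin \o
    ((fun k : nat => `|x k|%R) \+ (fun k : nat => `|y k|%R))%R] =
    (\sum_(0 <= k <oo) ((`|x k| + `|y k|) `^ p)%:E) `^ p^-1)%E.
  rewrite (Lnorm_counting _ p_gt0); congr (_ `^ _)%E.
  apply: eq_eseriesr => k _ /=.
  by rewrite ger0_norm ?addr_ge0.
rewrite lp_sum_Lnorm; apply: gt0_ler_poweR.
- by rewrite invr_ge0 ltW.
- by rewrite in_itv /= lp_sum_ge0 leey.
- rewrite in_itv /= leey andbT.
  by apply: nneseries_ge0 => k _ _; rewrite lee_fin powR_ge0.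
apply: lee_nneseries => [k _ _|k _]; first by rewrite lee_fin powR_ge0.
by rewrite lee_fin ge0_ler_powR// ?nnegrE ?addr_ge0 ?ler_normD// ltW.
Qed.

Lemma lp_sumZ a (x : nat -> X) : lp_sum (a *: x) = ((`|a| `^ p)%:E * lp_sum x)%E.
Proof.
rewrite /lp_sum -nneseriesZl; last by move=> k _; rewrite lee_fin powR_ge0.
by apply: eq_eseriesr => k _; rewrite [(a *: x) k]/(a *: x k) normrZ powRM.
Qed.

Lemma lp_submod_closed : submod_closed (lp_pred p1).
Proof.
split.
  apply/asboolP; rewrite /lp_sum eseries0// => k _ _.
  by rewrite [(0 : nat -> X) k]/(0 : X) normr0 powR0// gt_eqF.
move=> a x y /asboolP xp /asboolP yp; apply/asboolP.
rewrite -lp_sum_powlty (le_lt_trans (lp_normD_ereal _ _))//.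
by rewrite lte_add_pinfty// lp_sum_powlty// lp_sumZ lte_mul_pinfty// lee_fin powR_ge0.
Qed.

HB.instance Definition _ := GRing.isSubmodClosed.Build R (nat -> X)
  (lp_pred p1) lp_submod_closed.

Record lp := Lp { lp_fun :> nat -> X ; _ : lp_fun \in lp_pred p1 }.

HB.instance Definition _ := [isSub for lp_fun].
HB.instance Definition _ := [Choice of lp by <:].
HB.instance Definition _ := [SubChoice_isSubLmodule of lp by <:].

Definition lp_norm (x : lp) : R := lp_normf x.

Lemma lp_fin_num (x : lp) : lp_sum x \is a fin_num.
Proof.
by rewrite ge0_fin_numE ?lp_sum_ge0//; case: x => x /= /asboolP.
Qed.

Lemma lp_normE (x : lp) : ((lp_norm x)%:E = lp_sum x `^ p^-1)%E.
Proof. by rewrite /lp_norm /lp_normf -poweR_EFin fineK// lp_fin_num. Qed.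

Lemma lp_normD (x y : lp) : lp_norm (x + y) <= lp_norm x + lp_norm y.
Proof.
have := lp_normD_ereal (lp_fun x) (lp_fun y).
rewrite -[(lp_fun x + lp_fun y)%R]/(lp_fun (x + y)).
move: (lp_normE x) (lp_normE y) (lp_normE (x + y)).
generalize (lp_norm x) (lp_norm y) (lp_norm (x + y)) => a b c <- <- <-.
by rewrite -EFinD lee_fin.
Qed.

Lemma lp_normZ a (x : lp) : lp_norm (a *: x) = `|a| * lp_norm x.
Proof.
rewrite /lp_norm /lp_normf [X in lp_sum X]/(a *: (x : nat -> X)) lp_sumZ.
rewrite fineM ?lp_fin_num//= powRM ?powR_ge0 ?fine_ge0 ?lp_sum_ge0//.
by rewrite -powRrM mulfV ?gt_eqF// powRr1.
Qed.

Lemma lp_norm_eq0 (x : lp) : lp_norm x = 0 -> x = 0.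
Proof.
move=> /eqP; rewrite powR_eq0 => /andP[x0 _]; apply/val_inj/funext => k.
have : (lp_sum x <= 0)%E by rewrite -(fineK (lp_fin_num x)) (eqP x0).
move=> s0; apply/eqP; rewrite -normr_eq0.
have h : `|x k| `^ p <= 0.
  rewrite -lee_fin; apply: le_trans s0.
  apply: le_trans (nneseries_lim_ge k.+1 _); last first.
    by move=> i _ _; rewrite lee_fin powR_ge0.
  rewrite big_nat_recr//= leeDr// sume_ge0//.
have : `|x k| `^ p == 0 by rewrite eq_le h powR_ge0.
by rewrite powR_eq0 => /andP[].
Qed.

HB.instance Definition _ := Lmodule_isNormed.Build R lp
  lp_normD lp_normZ lp_norm_eq0.

Lemma lp_single_subproof (i : nat) (x : X) :
  (fun k => if k == i then x else 0) \in lp_pred p1.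
Proof.
apply/asboolP.
rewrite /lp_sum (@nneseries_split _ _ 0 i.+1); last first.
  by move=> k _; rewrite lee_fin powR_ge0.
rewrite [X in (_ + X)%E]eseries0 => [|k ik _]; last first.
  by rewrite gtn_eqF// normr0 powR0// gt_eqF.
by rewrite adde0 sumEFin ltry.
Qed.

Definition lp_single (i : nat) (x : X) : lp := Lp (lp_single_subproof i x).

Definition lp_basis {J : countType} (e : J -> X) (ij : nat * J) : lp :=
  lp_single ij.1 (e ij.2).

End lp.

Lemma lt2_le1 {R : realType} (p : R) : 2 < p -> 1 <= p.
Proof. by move=> p2; rewrite (le_trans _ (ltW p2))// ler1n. Qed.

Definition contractive_projection {R : realType} {Z : normedModType R}
    (P : bop Z Z) := (forall z, P (P z) = P z) /\ `|P| <= 1.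

Definition averaging_operator {R : realType} {I : countType}
    {Z : normedModType R} (e : I -> Z) (T : Z -> Z) :=
  exists (K : choiceType) (u : K -> Z) (v : K -> bop Z R^o),
    [/\ forall i j, i != j -> disjoint_in e (u i) (u j),
        forall i j, i != j -> dual_disjoint e (v i) (v j),
        forall i j, i != j -> v i (u j) = 0 &
        forall z, partial_sum (fun i => v i z *: u i) @ totally --> T z].

(* Schauder basis (y_i)_(i in D) of the subspace Y, where the index set D is
   either {0, ..., n - 1} or the set of all naturals *)
Definition schauder_basis {R : realType} {Z : normedModType R} (Y : set Z)
    (D : set nat) (y : nat -> Z) :=
  let expands a z :=
    (fun n => \sum_(0 <= i < n | i \in D) (a i : R) *: y i) @ \oo --> z in
  [/\ forall i j, (i <= j)%N -> D j -> D i,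
      forall i, D i -> Y (y i) &
      forall z, Y z -> exists2 a, expands a z &
        forall b, expands b z -> forall i, D i -> b i = a i].

Definition admits_block_basis {R : realType} {I : countType}
    {Z : normedModType R} (e : I -> Z) (Y : set Z) :=
  exists (D : set nat) (y : nat -> Z), schauder_basis Y D y /\
    forall i j, D i -> D j -> i != j -> disjoint_in e (y i) (y j).

(* Main.v *)
Require Import Defs.
From mathcomp Require Import all_boot all_order all_algebra.
From mathcomp Require Import all_classical all_reals all_analysis.
From mathcomp Require Import finmap ring lra.
From mathcomp.analysis Require Import summability.

Import Order.TTheory GRing.Theory Num.Theory.
Import numFieldNormedType.Exports.

Set Implicit Arguments.
Unset Strict Implicit.
Unset Printing Implicit Defensive.

Local Open Scope classical_set_scope.
Local Open Scope ring_scope.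

(* Write c_i for the coordinate functionals of a 1-unconditional basis and
   Y for the range of P.  If y is in Y and c_i y = 0, then
   |y + t e_i|^p <= |y|^p + o(t^2) by condition (iii) of disjointness
   reflection (or because p > 2, when the X-component of y met by e_i is 0).
   As P is contractive, |y + t P e_i|^p obeys the same bound, so the symmetric
   second difference of t |-> |y + t P e_i|^p at 0 is o(t^2).  It is a sum over
   the X-components of nonnegative terms, hence each of them is o(t^2), and
   condition (ii) makes y and P e_i disjoint: P preserves the disjoint
   complement of every y in Y.  Strict monotonicity of the norm, again a
   consequence of (ii), then shows that Y is stable under restriction to the
   support of any of its elements.  The intersections
   A_i = \bigcap {supp y | y in Y, c_i y <> 0} are therefore equal or disjoint,
   and restricting Y to A_i leaves a line, spanned by u_i with c_i u_i = 1; the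
   u_i form the block basis and P z = \sum_i c_i (P z) u_i. *)

(** * One-unconditional bases *)

#[local] Existing Instance totally_filter.

Lemma cvg_partial_sumP (R : realType) (I : choiceType) (Z : normedModType R)
    (f : I -> Z) (z : Z) :
  partial_sum f @ totally --> z <->
  forall eps : R, 0 < eps -> exists F : {fset I},
    forall G : {fset I}, (F `<=` G)%fset -> `|z - \sum_(i <- G) f i| < eps.
Proof.
split=> [/cvgrPdist_lt fz eps eps0|fz].
  have [F _ FP] := fz eps eps0; exists F => G FG.
  by rewrite big_seq_fsetE; exact: FP.
apply/cvgrPdist_lt => eps eps0; have [F FP] := fz eps eps0.
by exists F => // G /FP; rewrite big_seq_fsetE.
Qed.

Lemma eq0_le_eps (R : realType) (Z : normedModType R) (M : R) (z : Z) :
  (forall eps : R, 0 < eps -> `|z| <= M * eps) -> z = 0.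
Proof.
move=> h; apply/normr0_eq0/eqP; rewrite eq_le normr_ge0 andbT.
apply/ler_addgt0Pl => eps eps0; rewrite addr0.
have M0 : 0 < `|M| + 1 by rewrite ltr_wpDl.
apply: le_trans (h _ (divr_gt0 eps0 M0)) _.
rewrite mulrCA ger_pMr// ler_pdivrMr// mul1r.
by rewrite (le_trans (ler_norm _))// lerDl.
Qed.

Section bop_theory.
Context {R : realType} {V W : normedModType R}.

Lemma bop_linear (f : bop V W) a x y : f (a *: x + y) = a *: f x + f y.
Proof. by have [lf _] := bopP f; exact: lf. Qed.

Lemma bop0 (f : bop V W) : f 0 = 0.
Proof. by rewrite -(scale0r (0 : V)) bopZ scale0r. Qed.

Lemma bopD (f : bop V W) x y : f (x + y) = f x + f y.
Proof. by rewrite -{1}[x]scale1r bop_linear scale1r. Qed.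

Lemma bopN (f : bop V W) x : f (- x) = - f x.
Proof. by rewrite -scaleN1r bopZ scaleN1r. Qed.

Lemma bopB (f : bop V W) x y : f (x - y) = f x - f y.
Proof. by rewrite bopD bopN. Qed.

Lemma bop_sum (f : bop V W) (I : Type) (s : seq I) (F : I -> V) :
  f (\sum_(i <- s) F i) = \sum_(i <- s) f (F i).
Proof.
by elim: s => [|i s IH]; rewrite ?big_nil ?bop0// !big_cons bopD IH.
Qed.

Lemma bop_pred_intro (f : V -> W) (M : R) :
  (forall a x y, f (a *: x + y) = a *: f x + f y) ->
  (forall x, `|f x| <= M * `|x|) -> f \in @bop_pred R V W.
Proof. by move=> lf fM; apply/asboolP; split => //; exists M. Qed.

Lemma bop_cvg_partial_sum (I : choiceType) (f : bop V W) (u : I -> V) z :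
  partial_sum u @ totally --> z -> partial_sum (f \o u) @ totally --> f z.
Proof.
move=> /cvg_partial_sumP uz; apply/cvg_partial_sumP => eps eps0.
have N0 : 0 < `|f| + 1 by rewrite ltr_wpDl.
have [F FP] := uz _ (divr_gt0 eps0 N0); exists F => G /FP.
rewrite ltr_pdivlMr// -bop_sum -bopB; apply: le_lt_trans.
rewrite (le_trans (opnorm_ge f _))// mulrC ler_wpM2l//.
by rewrite lerDl.
Qed.

End bop_theory.

(** The inequality in [one_unconditional_basis] concerns finite sums, so on an infinite expansion a
    change of signs converges only by some form of completeness. Isolating the property lets it come
    from completeness in X and componentwise from X in l_p(X). *)
Definition sign_changes (R : realType) (I : countType) (Z : normedModType R)
    (e : I -> Z) := forall (s : I -> bool) z, exists z',
  Defs.coord e z' = (fun i => (-1) ^+ s i * Defs.coord e z i).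

Section one_unconditional.
Context {R : realType} {I : countType} {Z : normedModType R}.
Variable e : I -> Z.
Hypothesis e_basis : one_unconditional_basis e.
Implicit Types (x y z : Z) (a b : I -> R) (F G : {fset I}).

Local Notation coord := (Defs.coord e).

Lemma coord_expansion z : has_expansion e (coord z) z.
Proof.
have [a [az _]] := e_basis.1 z.
by rewrite /Defs.coord; case: xgetP => [b -> //|/(_ a)].
Qed.

Lemma coord_eq a z : has_expansion e a z -> coord z = a.
Proof.
have [b [_ bu]] := e_basis.1 z => az.
by rewrite -(bu _ az) -(bu _ (@coord_expansion z)).
Qed.

Lemma coord_inj x y : coord x = coord y -> x = y.
Proof.
move=> xy; have := @coord_expansion y; rewrite -xy.
move: (@coord_expansion x) => hx hy.
apply/eqP; rewrite -subr_eq0; apply/eqP/(@eq0_le_eps _ _ 2) => eps eps0.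
have [F FP] := (cvg_partial_sumP _ _).1 hx _ eps0.
have [G GP] := (cvg_partial_sumP _ _).1 hy _ eps0.
have := FP (F `|` G)%fset (fsubsetUl _ _).
have := GP (F `|` G)%fset (fsubsetUr _ _).
set s := \sum_(_ <- _) _ => ys xs.
have -> : x - y = (x - s) - (y - s) by rewrite opprB addrA subrK.
by rewrite (le_trans (ler_normB _ _))//; lra.
Qed.

Lemma has_expansion_linear k a b x y : has_expansion e a x ->
  has_expansion e b y ->
  has_expansion e (fun i => k * a i + b i) (k *: x + y).
Proof.
move=> /cvg_partial_sumP hx /cvg_partial_sumP hy.
apply/cvg_partial_sumP => eps eps0.
have k0 : 0 < `|k| + 1 by rewrite ltr_wpDl.
have [F FP] := hx _ (divr_gt0 (divr_gt0 eps0 (ltr0n R 2)) k0).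
have [G GP] := hy _ (divr_gt0 eps0 (ltr0n R 2)).
exists (F `|` G)%fset => H; rewrite fsubUset => /andP[/FP + /GP].
have -> : \sum_(i <- H) (k * a i + b i) *: e i =
    k *: \sum_(i <- H) a i *: e i + \sum_(i <- H) b i *: e i.
  rewrite scaler_sumr -big_split/=; apply: eq_bigr => i _.
  by rewrite scalerDl scalerA.
set s := \sum_(_ <- _) _; set t := \sum_(_ <- _) _ => xs yt.
have -> : k *: x + y - (k *: s + t) = k *: (x - s) + (y - t).
  by rewrite scalerBr opprD addrACA.
rewrite (le_lt_trans (ler_normD _ _))// normrZ.
suff : `|k| * `|x - s| <= eps / 2 by lra.
move: xs; rewrite ltr_pdivlMr// => /ltW; apply: le_trans.
by rewrite mulrDr mulr1 mulrC lerDl.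
Qed.

Lemma coord_linear k x y i : coord (k *: x + y) i = k * coord x i + coord y i.
Proof.
by rewrite (coord_eq (has_expansion_linear (k := k) (@coord_expansion x)
  (@coord_expansion y))).
Qed.

Lemma coord0 i : coord 0 i = 0.
Proof.
have := coord_linear 1 0 0 i.
by rewrite scaler0 addr0 mul1r; lra.
Qed.

Lemma coordZ k x i : coord (k *: x) i = k * coord x i.
Proof. by rewrite -[k *: x]addr0 coord_linear coord0 addr0. Qed.

Lemma coordD x y i : coord (x + y) i = coord x i + coord y i.
Proof. by rewrite -{1}[x]scale1r coord_linear mul1r. Qed.

Lemma coordN x i : coord (- x) i = - coord x i.
Proof. by rewrite -scaleN1r coordZ mulN1r. Qed.

Lemma coordB x y i : coord (x - y) i = coord x i - coord y i.
Proof. by rewrite coordD coordN. Qed.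

Lemma coord_sum (K : Type) (s : seq K) (u : K -> Z) i :
  coord (\sum_(k <- s) u k) i = \sum_(k <- s) coord (u k) i.
Proof.
by elim: s => [|k s IH]; rewrite ?big_nil ?coord0// !big_cons coordD IH.
Qed.

Lemma coord_basis i j : coord (e i) j = (j == i)%:R.
Proof.
rewrite (@coord_eq (fun j => (j == i)%:R))//.
apply/cvg_partial_sumP => eps eps0; exists [fset i]%fset => G.
rewrite fsub1set => iG.
rewrite (bigD1_seq i)//= ?fset_uniq// eqxx scale1r big1 ?addr0 ?subrr ?normr0//.
by move=> k /negPf ->; rewrite scale0r.
Qed.

Lemma coord_finite_sum F a i :
  coord (\sum_(k <- F) a k *: e k) i = if i \in F then a i else 0.
Proof.
rewrite coord_sum; case: ifPn => iF.
  rewrite (bigD1_seq i)//= ?fset_uniq// coordZ coord_basis eqxx mulr1.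
  rewrite big1 ?addr0// => k /negPf ki.
  by rewrite coordZ coord_basis eq_sym ki mulr0.
rewrite big_seq big1// => k kF; rewrite coordZ coord_basis.
by case: eqVneq kF iF => [->->|]//; rewrite mulr0.
Qed.

Lemma basis_neq0 i : e i != 0.
Proof.
apply/eqP => e0; have := coord_basis i i.
by rewrite e0 coord0 eqxx => /eqP; rewrite eq_sym oner_eq0.
Qed.

Lemma norm_sign_sum F a (s : I -> bool) :
  `|\sum_(i <- F) ((-1) ^+ s i * a i) *: e i| = `|\sum_(i <- F) a i *: e i|.
Proof.
apply/le_anti; rewrite e_basis.2/=.
apply: le_trans (e_basis.2 F (fun i => (-1) ^+ s i * a i) s).
rewrite le_eqVlt (_ : \sum_(i <- F) ((-1) ^+ s i * ((-1) ^+ s i * a i)) *: e i =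
  \sum_(i <- F) a i *: e i) ?eqxx//.
by apply: eq_bigr => i _; rewrite mulrA -expr2 sqrr_sign mul1r.
Qed.

(** The sum over [F] is the mean of the sum over [G] and of the same sum with signs changed off
    [F]. *)
Lemma norm_subsum F G a : (F `<=` G)%fset ->
  `|\sum_(i <- F) a i *: e i| <= `|\sum_(i <- G) a i *: e i|.
Proof.
move=> FG.
have -> : \sum_(i <- F) a i *: e i = 2^-1 *: (\sum_(i <- G) a i *: e i +
    \sum_(i <- G) ((-1) ^+ (i \notin F) * a i) *: e i).
  apply: coord_inj; apply/funext => i.
  rewrite coordZ coordD !coord_finite_sum.
  case: ifPn => iF; first by rewrite (fsubsetP FG)//= expr0; lra.
  by case: ifPn => _ /=; rewrite ?expr1; lra.
rewrite normrZ ger0_norm ?invr_ge0//.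
have := ler_normD (\sum_(i <- G) a i *: e i)
  (\sum_(i <- G) ((-1) ^+ (i \notin F) * a i) *: e i).
by rewrite norm_sign_sum; lra.
Qed.

Lemma norm_partial_expansion z F : `|\sum_(i <- F) coord z i *: e i| <= `|z|.
Proof.
apply/ler_addgt0Pl => eps eps0.
have [G GP] := (cvg_partial_sumP _ _).1 (@coord_expansion z) _ eps0.
have := GP (F `|` G)%fset (fsubsetUr _ _).
have := norm_subsum (coord z) (fsubsetUl F G).
set s := \sum_(_ <- (F `|` G)%fset) _ => Fs zs; rewrite (le_trans Fs)//.
have -> : s = z - (z - s) by rewrite opprB addrC subrK.
by rewrite (le_trans (ler_normB _ _))//; lra.
Qed.

Lemma norm_coord_basis z i : `|coord z i| * `|e i| <= `|z|.
Proof.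
by have := norm_partial_expansion z [fset i]%fset; rewrite big_seq_fset1 normrZ.
Qed.

Lemma coord_bop_subproof i : (fun z => coord z i : R^o) \in @bop_pred R Z R^o.
Proof.
apply: (@bop_pred_intro _ _ _ _ `|e i|^-1) => [k x y|x].
  by rewrite coord_linear.
by rewrite mulrC ler_pdivlMr ?normr_gt0 ?basis_neq0// norm_coord_basis.
Qed.

Definition coord_bop i : bop Z R^o := Bop (coord_bop_subproof i).

Lemma coord_cvg_partial_sum (K : choiceType) (u : K -> Z) z i :
  partial_sum u @ totally --> z ->
  partial_sum (fun k => coord (u k) i : R^o) @ totally --> (coord z i : R^o).
Proof. exact: (bop_cvg_partial_sum (f := coord_bop i)). Qed.

Hypothesis e_signs : sign_changes e.

Definition flip (s : I -> bool) z : Z := projT1 (cid (e_signs s z)).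

Lemma coord_flip s z i : coord (flip s z) i = (-1) ^+ s i * coord z i.
Proof. by rewrite /flip; case: cid => /= z' ->. Qed.

Lemma norm_flip_le s z : `|flip s z| <= `|z|.
Proof.
apply/ler_addgt0Pl => eps eps0.
have [F FP] := (cvg_partial_sumP _ _).1 (@coord_expansion (flip s z)) _ eps0.
have := FP F (fsubset_refl _); under eq_bigr do rewrite coord_flip.
have := norm_partial_expansion z F; rewrite -(norm_sign_sum _ _ s).
set w := \sum_(_ <- _) _ => wz zw.
have -> : flip s z = (flip s z - w) + w by rewrite subrK.
by rewrite (le_trans (ler_normD _ _))//; lra.
Qed.

Lemma flip_linear s k x y : flip s (k *: x + y) = k *: flip s x + flip s y.
Proof.
apply: coord_inj; apply/funext => i.
by rewrite coord_flip !coord_linear !coord_flip; ring.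
Qed.

Lemma flip_basis s i : flip s (e i) = (-1) ^+ s i *: e i.
Proof.
apply: coord_inj; apply/funext => j.
rewrite coord_flip coordZ coord_basis.
by have [->//|] := eqVneq; rewrite !mulr0.
Qed.

(** The band projection onto [A], written as the mean of [z] and its sign change off [A]: this makes
    it a contraction at once. *)
Definition restr (A : set I) z : Z :=
  2^-1 *: (z + flip (fun i => i \notin A) z).

Lemma coord_restr A z i : coord (restr A z) i = if i \in A then coord z i else 0.
Proof.
by rewrite coordZ coordD coord_flip; case: (i \in A) => /=;
  rewrite ?expr0 ?expr1; lra.
Qed.

Lemma norm_restr_le A z : `|restr A z| <= `|z|.
Proof.
rewrite normrZ ger0_norm ?invr_ge0//.
have := ler_normD z (flip (fun i => i \notin A) z).
by have := norm_flip_le (fun i => i \notin A) z; lra.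
Qed.

(** If [z] vanishes on the part of [F] inside [A], subtracting the partial sum over [F] does not
    alter the restriction to [A], and restriction is contractive. *)
Lemma restr_small z (eps : R) : 0 < eps -> exists F, forall A : set I,
  (forall i, i \in F -> A i -> coord z i = 0) -> `|restr A z| < eps.
Proof.
move=> eps0.
have [F FP] := (cvg_partial_sumP _ _).1 (@coord_expansion z) _ eps0.
exists F => A AF; apply: le_lt_trans (FP F (fsubset_refl _)).
rewrite (_ : restr A z = restr A (z - \sum_(i <- F) coord z i *: e i)).
  exact: norm_restr_le.
apply: coord_inj; apply/funext => i.
rewrite !coord_restr; case: ifPn => // /set_mem Ai.
rewrite coordB coord_finite_sum; case: ifPn => iF; last by rewrite subr0.
by rewrite subrr (AF i).
Qed.

(** The modulus of a vector is its sign change at the negative coordinates. This ties lattice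
    disjointness to supports. *)
Lemma disjoint_inP x y :
  disjoint_in e x y <-> forall i, coord x i = 0 \/ coord y i = 0.
Proof.
pose abs z := flip (fun i => coord z i < 0) z.
have coord_abs z i : coord (abs z) i = `|coord z i|.
  rewrite coord_flip; have [z0|z0] := ltrP (coord z i) 0 => /=.
    by rewrite expr1 ltr0_norm// mulN1r.
  by rewrite expr0 mul1r ger0_norm.
split=> [[mx [my [[xmx xmx' _] [ymy ymy' _] [_ _ mP]]]] i|xy].
  (* The vector [c *: e i] lies below both moduli, hence below their meet 0, which forces [c] to
     vanish. *)
  set c := Num.min `|coord x i| `|coord y i|.
  have le_m z m : coord_le e z m -> coord_le e (- z) m ->
      forall j, `|coord z j| <= coord m j.
    move=> zm zm' j; rewrite ler_norml lerNl -coordN.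
    by rewrite zm' zm.
  have le_c m : c <= coord m i -> (forall j, 0 <= coord m j) ->
      coord_le e (c *: e i) m.
    move=> cm m0 j; rewrite coordZ coord_basis.
    by have [->|_] := eqVneq; rewrite ?mulr1 ?mulr0.
  have : coord_le e (c *: e i) 0.
    apply: mP; apply: le_c => [|j].
    - by apply: le_trans (le_m x mx _ _ i) => //; rewrite ge_min lexx.
    - by apply: le_trans (le_m x mx _ _ j).
    - by apply: le_trans (le_m y my _ _ i) => //; rewrite ge_min lexx orbT.
    - by apply: le_trans (le_m y my _ _ j).
  move=> /(_ i); rewrite coordZ coord_basis eqxx mulr1 coord0 ge_min.
  by rewrite !normr_le0 => /orP[/eqP|/eqP]; [left|right].
have join z : is_join (coord_le e) z (- z) (abs z).
  split=> [i|i|w zw zw' i]; rewrite coord_abs ?coordN ?ler_norm//.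
    by rewrite -normrN ler_norm.
  by rewrite ler_norml lerNl -coordN zw zw'.
exists (abs x), (abs y); split => //; split=> [i|i|w wx wy i].
- by rewrite coord_abs coord0.
- by rewrite coord_abs coord0.
- have := wx i; have := wy i; rewrite !coord_abs coord0.
  by have [->|->] := xy i; rewrite normr0.
Qed.

Lemma bop_expansion (v : bop Z R^o) z :
  partial_sum (fun i => coord z i * v (e i) : R^o) @ totally --> v z.
Proof.
have := bop_cvg_partial_sum (f := v) (@coord_expansion z).
rewrite (_ : v \o _ = fun i => coord z i * v (e i) : R^o)//.
by apply/funext => i; rewrite /= bopZ.
Qed.

(** Basis vectors are positive; conversely the values at a positive vector are limits of
    combinations, with nonnegative coefficients, of the values at basis vectors. *)
Lemma dual_leP (v w : bop Z R^o) :
  dual_le e v w <-> forall i, v (e i) <= w (e i).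
Proof.
split=> [vw i|vw z z0].
  by apply: vw => j; rewrite coord0 coord_basis ler0n.
apply/ler_addgt0Pl => eps eps0.
have e2 : 0 < eps / 2 by rewrite divr_gt0.
have [F FP] := (cvg_partial_sumP _ _).1 (@bop_expansion v z) _ e2.
have [G GP] := (cvg_partial_sumP _ _).1 (@bop_expansion w z) _ e2.
have /ltr_distlCDr := GP (F `|` G)%fset (fsubsetUr _ _).
have /ltr_distlDr := FP (F `|` G)%fset (fsubsetUl _ _).
suff : \sum_(i <- (F `|` G)%fset) coord z i * v (e i) <=
    \sum_(i <- (F `|` G)%fset) coord z i * w (e i) by lra.
apply: ler_sum => i _; rewrite ler_wpM2l//.
by have := z0 i; rewrite coord0.
Qed.

(** The modulus of a functional is its composition with the sign change at the indices where it is
    negative on the basis. *)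
Lemma dual_disjoint_intro (v w : bop Z R^o) :
  (forall i, v (e i) = 0 \/ w (e i) = 0) -> dual_disjoint e v w.
Proof.
have abs_ex (u : bop Z R^o) : exists au : bop Z R^o,
    forall i, au (e i) = `|u (e i)|.
  pose s i := u (e i) < 0.
  have us : (u \o flip s) \in @bop_pred R Z R^o.
    apply: (@bop_pred_intro _ _ _ _ `|u|) => [k x y|x] /=.
      by rewrite flip_linear bop_linear.
    apply: le_trans (opnorm_ge u _) _.
    by apply: ler_wpM2l; [exact: (normr_ge0 u)|exact: norm_flip_le].
  exists (Bop us) => i; rewrite /= flip_basis bopZ /s /GRing.scale/=.
  have [u0|u0] := ltrP (u (e i)) 0 => /=.
    by rewrite expr1 ltr0_norm// mulN1r.
  by rewrite expr0 mul1r ger0_norm.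
move=> vw; have [av avE] := abs_ex v; have [aw awE] := abs_ex w.
have join (u au : bop Z R^o) : (forall i, au (e i) = `|u (e i)|) ->
    is_join (dual_le e) u (- u) au.
  move=> auE; split=> [||m /dual_leP um /dual_leP um'];
    apply/dual_leP => i; rewrite auE ?ler_norm//.
    by rewrite -normrN ler_norm.
  by rewrite ler_norml um andbT lerNl; exact: um'.
exists av, aw; split; [exact: join|exact: join|split].
- by apply/dual_leP => i; rewrite avE; exact: normr_ge0.
- by apply/dual_leP => i; rewrite awE; exact: normr_ge0.
- move=> m /dual_leP mv /dual_leP mw; apply/dual_leP => i.
  have := mv i; have := mw i; rewrite avE awE.
  by have [->|->] := vw i; rewrite normr0.
Qed.

End one_unconditional.

(** * Range of a projection that respects supports *)

(** The set [D] has the shape that [schauder_basis] asks of an index set. The values are options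
    because [I] may be empty. *)
Lemma countType_enumeration (I : countType) (A : set I) :
  exists (D : set nat) (f : nat -> option I),
    [/\ forall i j, (i <= j)%N -> D j -> D i,
        forall n, D n -> exists2 i, A i & f n = Some i,
        forall m n, D m -> D n -> f m = f n -> m = n &
        forall i, A i -> exists2 n, D n & f n = Some i].
Proof.
suff [D [dcD cardD]] : exists D : set nat,
    (forall i j, (i <= j)%N -> D j -> D i) /\ (D #= (Some @` A))%card.
  have /card_set_bijP[f [fD finj fsurj]] := cardD.
  exists D, f; split => // [n /fD[i Ai <-]|m n Dm Dn fmn|i Ai].
  - by exists i.
  - by apply: finj => //; exact: mem_set.
  - by have [n Dn fn] := fsurj (Some i) (ex_intro2 _ _ i Ai erefl); exists n.
have [/finite_setP[n An]|/infiniteP An] := pselect (finite_set (Some @` A)).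
  exists `I_n; split; last by rewrite card_eq_sym.
  by move=> i j ij /= jn; exact: leq_ltn_trans jn.
exists setT; split => //; rewrite card_eq_le An/=.
exact: countableP.
Qed.

Section projection_range.
Context {R : realType} {I : countType} {Z : normedModType R}.
Variable e : I -> Z.
Hypothesis e_basis : one_unconditional_basis e.
Hypothesis e_signs : sign_changes e.
Variable P : bop Z Z.
Hypothesis P_idem : forall z, P (P z) = P z.

Local Notation coord := (Defs.coord e).
Local Notation restr := (restr e_signs).
Local Notation fixed z := (P z = z).

(** In this section contractivity is replaced by the next two properties; they are derived from it
    in the last part. *)
Hypothesis P_band : forall y i k, fixed y ->
  coord y i = 0 -> coord y k != 0 -> coord (P (e i)) k = 0.
Hypothesis P_restr : forall y z, fixed y -> fixed z ->
  fixed (restr (Defs.support e y) z).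

(** When no fixed vector charges [i] this is the whole of [I], whence the guard [range_support] in
    what follows. *)
Definition atom (i : I) : set I :=
  [set k | forall y, fixed y -> coord y i != 0 -> coord y k != 0].

Definition range_support : set I :=
  [set i | exists2 y, fixed y & coord y i != 0].

Lemma fixedB y z : fixed y -> fixed z -> fixed (y - z).
Proof. by move=> Py Pz; rewrite bopB Py Pz. Qed.

Lemma fixedZ a z : fixed z -> fixed (a *: z).
Proof. by move=> Pz; rewrite bopZ Pz. Qed.

Lemma restr_comp A B z : restr A (restr B z) = restr (A `&` B) z.
Proof.
apply: (coord_inj e_basis); apply/funext => i; rewrite !coord_restr//.
by rewrite in_setI; case: (i \in A).
Qed.

(** Each [k] in [F] outside the atom is excluded by the support of one fixed vector that charges [i]
    but not [k]. The intersection of these finitely many supports is [B], and [P_restr] applies to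
    them one after the other. *)
Lemma atom_approx i (F : seq I) : exists B : set I,
  [/\ atom i `<=` B, forall k, k \in F -> B k -> atom i k &
      forall z, fixed z -> fixed (restr B z)].
Proof.
elim: F => [|k F [B [iB FB PB]]].
  exists setT; split=> // z Pz.
  rewrite (_ : restr _ z = z)//; apply: (coord_inj e_basis); apply/funext => j.
  by rewrite coord_restr// in_setT.
have [ik|] := pselect (atom i k).
  by exists B; split => // j; rewrite inE => /predU1P[->//|/FB]; exact.
move/existsNP => [y /not_implyP[Py /not_implyP[yi yk]]].
exists (Defs.support e y `&` B); split.
- by move=> j ij; split; [exact: ij|exact: iB].
- by move=> j; rewrite inE => /predU1P[->[]//|/FB h [_ /h]].
- by move=> z Pz; rewrite -restr_comp; apply: P_restr => //; exact: PB.
Qed.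

(** An atom may be an infinite intersection of supports, so a limit is taken: restrictions to the
    sets of [atom_approx] are fixed, they approximate the restriction to the atom, and [P] is
    bounded. *)
Lemma restr_atom_fixed i z : fixed z -> fixed (restr (atom i) z).
Proof.
move=> Pz; apply/eqP; rewrite -subr_eq0; apply/eqP.
apply: (@eq0_le_eps _ _ (`|P| + 1)) => eps eps0.
have [F Fsmall] := restr_small e_basis e_signs z eps0.
have [B [iB FB PB]] := atom_approx i F.
(* The set [B] minus the atom misses [F], so this error is small. *)
set w := restr (B `\` atom i) z.
have weps : `|w| <= eps by apply/ltW/Fsmall => k /FB kB [/kB].
have -> : restr (atom i) z = restr B z - w.
  apply: (coord_inj e_basis); apply/funext => k.
  rewrite coordB// !coord_restr// in_setD.
  case: (boolP (k \in atom i)) => /=; last first.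
    by move=> _; rewrite andbT; lra.
  by move=> /set_mem/iB/mem_set ->; rewrite subr0.
rewrite bopB PB// opprB addrC addrA subrK addrC.
rewrite (le_trans (ler_normD _ _))// normrN mulrDl mul1r lerD//.
apply: le_trans (opnorm_ge P _) _.
by apply: ler_wpM2l => //; exact: (normr_ge0 P).
Qed.

Lemma atom_generator i : range_support i -> exists u,
  [/\ fixed u, coord u i = 1 & forall k, coord u k != 0 <-> atom i k].
Proof.
move=> [y Py yi]; exists ((coord y i)^-1 *: restr (atom i) y).
have ii : i \in atom i by apply/mem_set => z.
split.
- by apply: fixedZ; exact: restr_atom_fixed.
- by rewrite coordZ// coord_restr// ii mulVf.
- move=> k; rewrite coordZ// coord_restr//; split.
    by case: ifPn => [/set_mem//|]; rewrite mulr0 eqxx.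
  by move=> ik; rewrite mem_set// mulf_neq0 ?invr_neq0//; exact: ik.
Qed.

(** The difference [w] of the two sides is fixed and vanishes at [i]. If it charged some [k], then
    [k] would lie in the atom, and removing from [u] its part on the support of [w] would give a
    fixed vector charging [i] but not [k]. *)
Lemma restr_atom i u z : fixed u -> coord u i = 1 ->
  (forall k, coord u k != 0 <-> atom i k) -> fixed z ->
  restr (atom i) z = coord z i *: u.
Proof.
move=> Pu ui uatom Pz.
have ii : i \in atom i by apply/mem_set => y.
apply/eqP; rewrite -subr_eq0; apply/eqP; set w := _ - _.
have Pw : fixed w by apply: fixedB; [exact: restr_atom_fixed|exact: fixedZ].
have wi : coord w i = 0.
  by rewrite coordB// coord_restr// ii coordZ// ui mulr1 subrr.
apply: (coord_inj e_basis); apply/funext => k; rewrite coord0//.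
apply/eqP/negPn/negP => wk.
have ik : atom i k.
  apply: contrapT => nik; move/eqP : wk; apply.
  rewrite coordB// coord_restr// coordZ// memNset// sub0r.
  by have [->|/uatom//] := eqVneq (Defs.coord e u k) 0; rewrite mulr0 oppr0.
have /ik : fixed (u - restr (Defs.support e w) u) by apply: fixedB => //; exact: P_restr.
rewrite coordB// coord_restr// ui memNset/=; last by rewrite /Defs.support/= wi eqxx.
rewrite subr0 oner_neq0 => /(_ isT).
by rewrite coordB// coord_restr// mem_set// subrr eqxx.
Qed.

Lemma atom_range_support i k : range_support i -> atom i k -> range_support k.
Proof. by move=> [y Py yi] /(_ y Py yi); exists y. Qed.

Lemma atom_eq i k : range_support i -> atom i k -> atom k = atom i.
Proof.
move=> Si ik; have [u [Pu ui uatom]] := atom_generator Si.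
(* A fixed vector vanishing at [i] has zero restriction to the atom of [i], by [restr_atom], so it
   vanishes at [k] too. *)
have ki : atom k i.
  move=> y Py; apply: contra => /eqP yi.
  have := restr_atom Pu ui uatom Py => /(congr1 (fun z => coord z k)).
  by rewrite coord_restr// mem_set// coordZ// yi mul0r => ->.
apply/seteqP; split=> l h y Py yi; apply: h => //; [exact: ik|exact: ki].
Qed.

(* One representative per atom: its element with the smallest code. *)
Definition block_index : set I :=
  [set i | range_support i /\
           forall k, atom i k -> (choice.pickle i <= choice.pickle k)%N].

Lemma block_index_ex k : range_support k -> exists2 i, block_index i & atom i k.
Proof.
move=> Sk.
have ex : exists n, `[< exists2 l, atom k l & choice.pickle l = n >].
  by exists (choice.pickle k); apply/asboolP; exists k.
have [n /asboolP[i ki <-] imin] := ex_minnP ex.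
have ik : atom i = atom k by exact: atom_eq.
exists i; last by rewrite ik => y.
split; first exact: atom_range_support ki.
by rewrite ik => l kl; apply: imin; apply/asboolP; exists l.
Qed.

Lemma block_index_disjoint i j k : block_index i -> block_index j ->
  atom i k -> atom j k -> i = j.
Proof.
move=> [Si imin] [Sj jmin] ik jk.
have ij : atom i = atom j by rewrite -(atom_eq Si ik) (atom_eq Sj jk).
apply: (pcan_inj choice.pickleK); apply/anti_leq.
by apply/andP; split; [apply: imin; rewrite ij => y|apply: jmin; rewrite -ij => y].
Qed.

(** The value 0 off [block_index] lets all of [I] index the blocks, without a subtype of
    representatives. *)
Lemma blocks_ex : exists u : I -> Z, forall i,
  (block_index i -> [/\ fixed (u i), coord (u i) i = 1 &
                      forall k, coord (u i) k != 0 <-> atom i k]) /\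
  (~ block_index i -> u i = 0).
Proof.
suff H i : exists w, (block_index i -> [/\ fixed w, coord w i = 1 &
    forall k, coord w k != 0 <-> atom i k]) /\ (~ block_index i -> w = 0).
  by have [u uP] := choice H; exists u.
have [ri|nri] := pselect (block_index i); last by exists 0; split.
by have [w uw] := atom_generator ri.1; exists w.
Qed.

Variable u : I -> Z.
Hypothesis u_block : forall i, block_index i ->
  [/\ fixed (u i), coord (u i) i = 1 & forall k, coord (u i) k != 0 <-> atom i k].
Hypothesis u_junk : forall i, ~ block_index i -> u i = 0.

Lemma coord_block0 i k : ~ (block_index i /\ atom i k) -> coord (u i) k = 0.
Proof.
move=> nik; have [ri|/u_junk ->] := pselect (block_index i); last by rewrite coord0.
have [_ _ /(_ k)[uk _]] := u_block ri.
by apply/eqP/negPn/negP => /uk ?; exact: nik.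
Qed.

Lemma blocks_disjoint i j : i != j -> disjoint_in e (u i) (u j).
Proof.
move=> ij; apply/(disjoint_inP e_basis e_signs) => k.
have [[ri ik]|nik] := pselect (block_index i /\ atom i k); last first.
  by left; exact: coord_block0.
right; apply: coord_block0 => -[rj jk].
by move/eqP: ij; apply; exact: block_index_disjoint jk.
Qed.

(** Atoms of distinct representatives are disjoint, so at each coordinate at most one term survives,
    and [restr_atom] identifies it. *)
Lemma block_sum (s : seq I) z : uniq s -> fixed z ->
  \sum_(i <- s) coord z i *: u i =
  restr [set k | exists i, [/\ i \in s, block_index i & atom i k]] z.
Proof.
move=> us Pz; apply: (coord_inj e_basis); apply/funext => k.
rewrite coord_sum// coord_restr//; case: ifPn => [/set_mem[i [is_ ri ik]]|].
  rewrite (bigD1_seq i)//= [X in _ + X]big1 ?addr0.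
    have [Pu ui uat] := u_block ri.
    have /(congr1 (fun z => coord z k)) := restr_atom Pu ui uat Pz.
    by rewrite coord_restr// mem_set// => ->.
  move=> j ji; rewrite coordZ// coord_block0 ?mulr0// => -[rj jk].
  by move/eqP: ji; apply; exact: block_index_disjoint ik.
rewrite notin_setE/= => nk.
rewrite big_seq big1// => i is_.
rewrite coordZ// coord_block0 ?mulr0// => -[ri ik].
by apply: nk; exists i.
Qed.

(** Finitely many atoms cover the coordinates charged by [z] in the finite set of [restr_small]. By
    [block_sum] the remainder is the restriction of [z] to the complement of a union containing
    these atoms, hence small. *)
Lemma block_expansion z (eps : R) : fixed z -> 0 < eps ->
  exists2 F : seq I, (forall i, i \in F -> block_index i) &
  forall s : seq I, uniq s -> {subset F <= s} ->
    `|z - \sum_(i <- s) coord z i *: u i| < eps.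
Proof.
move=> Pz eps0; have [F Fsmall] := restr_small e_basis e_signs z eps0.
have [G Gblock FG] : exists2 G : seq I, (forall i, i \in G -> block_index i) &
    forall k, k \in (F : seq I) -> coord z k != 0 ->
      exists2 i, i \in G & atom i k.
  elim: (F : seq I) => [|k s [G Gb sG]]; first by exists [::].
  have [zk|zk] := eqVneq (coord z k) 0.
    exists G => // j; rewrite inE => /predU1P[->|]; first by rewrite zk eqxx.
    exact: sG.
  have [i bi ik] := block_index_ex (ex_intro2 _ _ z Pz zk).
  exists (i :: G) => j; rewrite inE => /predU1P[->//|].
  - exact: Gb.
  - by move=> _; exists i; rewrite ?inE ?eqxx.
  - by move=> js zj; have [l lG lj] := sG j js zj; exists l; rewrite ?inE ?lG ?orbT.
exists G => // s us Gs; rewrite block_sum//; set B := [set k | _].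
rewrite (_ : z - _ = restr (~` B) z).
  apply: Fsmall => k kF nBk; apply/eqP/negPn/negP => zk.
  have [i iG ik] := FG k kF zk.
  by apply: nBk; exists i; split => //; [exact: Gs|exact: Gblock].
apply: (coord_inj e_basis); apply/funext => k.
rewrite coordB// !coord_restr// in_setC.
by case: (k \in B); rewrite /= ?subrr ?subr0.
Qed.

Lemma block_functional_subproof i :
  (fun z => if `[< block_index i >] then coord (P z) i else 0 : R^o)
  \in @bop_pred R Z R^o.
Proof.
case: asboolP => _; last first.
  apply: (@bop_pred_intro _ _ _ _ 0) => [a x y|x]; last by rewrite normr0 mul0r.
  by rewrite scaler0 addr0.
apply: (@bop_pred_intro _ _ _ _ (`|e i|^-1 * `|P|)) => [a x y|x].
  by rewrite bop_linear coord_linear.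
rewrite -mulrA mulrC ler_pdivlMr ?normr_gt0 ?basis_neq0//.
apply: le_trans (norm_coord_basis e_basis _ _) _.
exact: opnorm_ge.
Qed.

Definition block_functional i : bop Z R^o := Bop (block_functional_subproof i).

Lemma projection_averaging : averaging_operator e P.
Proof.
have dichotomy i : block_index i -> coord (u i) i != 0.
  by move=> bi; have [_ -> _] := u_block bi; rewrite oner_neq0.
exists I, u, block_functional; split.
- by move=> i j; exact: blocks_disjoint.
- move=> i j ij; apply: (dual_disjoint_intro e_basis e_signs) => k /=.
  case: asboolP => bi; last by left.
  case: asboolP => bj; last by right.
  (* Off the atom of [l] the block [u l] vanishes while it charges [l], so [P_band] applies to it:
     the functional of [l] is carried by the atom of [l]. *)
  have h l : block_index l -> ~ atom l k -> coord (P (e k)) l = 0.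
    move=> bl nlk; have [Pu _ _] := u_block bl.
    apply: (P_band Pu); last exact: dichotomy.
    by apply: coord_block0 => -[].
  have [ik|nik] := pselect (atom i k); last by left; exact: h.
  right; apply: h => // jk.
  by move/eqP: ij; apply; exact: block_index_disjoint jk.
- move=> i j ij /=; case: asboolP => // bi.
  have [bj|/u_junk ->] := pselect (block_index j); last by rewrite bop0 coord0.
  have [-> _ _] := u_block bj; apply: coord_block0 => -[_ ji].
  by move/eqP: ij; apply; exact: block_index_disjoint ji.
- move=> z; apply/cvg_partial_sumP => eps eps0.
  have [F Fb FP] := block_expansion (P_idem z) eps0.
  exists [fset i in F]%fset => G FG.
  have := FP G (fset_uniq G).
  rewrite (eq_bigr (fun i => block_functional i z *: u i)).
    by apply => i iF; apply: (fsubsetP FG); rewrite inE.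
  move=> i _ /=; case: asboolP => // /u_junk ->.
  by rewrite !scaler0.
Qed.

Lemma projection_block_basis : admits_block_basis e (range P).
Proof.
have [D [f [Ddc fD finj fsurj]]] := countType_enumeration block_index.
have rangeP z : range P z <-> fixed z.
  by split=> [[x _ <-]//|Pz]; exists z.
exists D, (fun n => oapp u 0 (f n)); split; last first.
  move=> i j Di Dj ij; have [k bk fi] := fD i Di; have [l bl fj] := fD j Dj.
  rewrite fi fj; apply: blocks_disjoint; apply/eqP => kl.
  by move/eqP: ij; apply; apply: finj => //; rewrite fi fj kl.
split=> // [i Di|z /rangeP Pz].
  have [k bk ->] := fD i Di; apply/rangeP.
  by have [] := u_block bk.
exists (fun n => oapp (coord z) 0 (f n)).
  apply/cvgrPdist_lt => eps eps0.
  have [F Fb FP] := block_expansion Pz eps0.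
  (* The blocks met by the first [n] terms, as a list without duplicates, to which [block_expansion]
     applies. *)
  pose s n := pmap f [seq i <- index_iota 0 n | i \in D].
  have us n : uniq (s n).
    rewrite /s; have : uniq [seq i <- index_iota 0 n | i \in D].
      by rewrite filter_uniq// iota_uniq.
    have : all (fun i => i \in D) [seq i <- index_iota 0 n | i \in D].
      exact: filter_all.
    elim: [seq _ <- _ | _] => //= i t IH /andP[iD tD] /andP[it ut].
    have [k bk fi] := fD i (set_mem iD); rewrite fi/= IH// andbT.
    apply/negP; rewrite mem_pmap => /mapP[j jt kj].
    move/negP: it; apply; rewrite (finj i j) ?fi//.
    - exact: set_mem.
    - by apply: set_mem; exact: (allP tD).
  (* [N] exceeds the positions of all blocks of [F] in the enumeration. *)
  have [N NF] : exists N, forall i, i \in F -> exists2 n, (n < N)%N & D n /\ f n = Some i.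
    elim: F Fb {FP} => [|i F IH] Fb; first by exists 0%N.
    have [|N NP] := IH; first by move=> j jF; apply: Fb; rewrite inE jF orbT.
    have [|n Dn fn] := fsurj i; first by apply: Fb; rewrite inE eqxx.
    exists (maxn N n.+1) => j; rewrite inE => /predU1P[->|/NP[m mN ?]].
      by exists n => //; rewrite leq_max ltnSn orbT.
    by exists m => //; rewrite leq_max mN.
  exists N => // n /= Nn.
  have := FP (s n) (us n); rewrite /s big_pmap big_filter.
  have -> : \sum_(0 <= i < n | i \in D) oapp (coord z) 0 (f i) *: oapp u 0 (f i) =
     \sum_(0 <= i < n | i \in D) oapp (fun k => coord z k *: u k) 0 (f i).
    by apply: eq_bigr => i _; case: (f i) => //=; rewrite scale0r.
  apply=> i /NF[m mN [Dm fm]]; rewrite mem_pmap -fm; apply: map_f.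
  by rewrite mem_filter mem_set// mem_index_iota/= (leq_trans mN).
move=> b bz i Di; have [k bk fi] := fD i Di; rewrite fi/=.
have [_ uk _] := u_block bk.
(* Uniqueness: [k] lies in the atom of the block numbered [i] only, so coordinate [k] of every later
   partial sum is exactly [b i]. *)
have cb n : (i < n)%N ->
    coord (\sum_(0 <= i < n | i \in D) b i *: oapp u 0 (f i)) k = b i.
  move=> in_; rewrite -big_filter coord_sum// (bigD1_seq i)/=; last first.
  - by rewrite filter_uniq// iota_uniq.
  - by rewrite mem_filter mem_set// mem_index_iota.
  rewrite fi/= coordZ// uk mulr1 big_seq_cond big1 ?addr0// => j.
  rewrite mem_filter => /andP[/andP[/set_mem Dj _] ji].
  have [l bl fj] := fD j Dj; rewrite fj/= coordZ// coord_block0 ?mulr0//.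
  move=> -[_ lk]; move/eqP: ji; apply; apply: finj => //; rewrite fi fj.
  by congr Some; apply: block_index_disjoint lk _ => // y.
apply/eqP; rewrite -subr_eq0; apply/eqP.
apply: (@eq0_le_eps _ R^o `|e k|^-1) => eps eps0.
move/cvgrPdist_lt: bz => /(_ eps eps0)[N _ NP].
have := NP (maxn N i.+1) (leq_maxl _ _); set w := \sum_(0 <= _ < _ | _) _.
move=> zw.
have -> : b i - coord z k = - coord (z - w) k.
  by rewrite coordB// cb ?leq_maxr//; ring.
rewrite normrN mulrC ler_pdivlMr ?normr_gt0 ?basis_neq0//.
exact: le_trans (norm_coord_basis e_basis _ _) (ltW zw).
Qed.

End projection_range.

(** * The space l_p(X) *)

(** The Cauchy criterion passes from the expansion of [z] to the one with changed signs, since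
    finite sums keep their norm. *)
Lemma complete_basis_signs (R : realType) (I : countType)
    (X : completeNormedModType R) (e : I -> X) :
  one_unconditional_basis e -> sign_changes e.
Proof.
move=> e_basis s z; set a := Defs.coord e z.
pose f i : X := ((-1) ^+ s i * a i) *: e i.
suff /cvg_ex[z' z'P] : cvg (partial_sum f @ totally).
  by exists z'; exact: coord_eq.
apply: cauchy_cvg; apply: cauchy_exP => eps eps0.
have e2 : 0 < eps / 2 by rewrite divr_gt0.
have [F FP] := (cvg_partial_sumP _ _).1 (coord_expansion e_basis (z := z)) _ e2.
exists (\sum_(i <- F) f i); exists F => // G FG.
rewrite -ball_normE /= (_ : partial_sum f G = \sum_(i <- G) f i); last first.
  by rewrite big_seq_fsetE.
(* A difference of partial sums becomes a single finite sum, where signs can be removed; it is then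
   split again for the original coefficients. *)
have split_sum (b : I -> R) : \sum_(i <- F) b i *: e i - \sum_(i <- G) b i *: e i
    = - \sum_(i <- (G `\` F)%fset) b i *: e i.
  apply: (coord_inj e_basis); apply/funext => i.
  rewrite coordB// coordN// !coord_finite_sum// in_fsetD.
  case: (boolP (i \in F)) => /= [iF|_]; last by rewrite sub0r.
  by rewrite (fsubsetP FG)// subrr oppr0.
rewrite /f split_sum normrN norm_sign_sum// -normrN -split_sum.
have /= h1 := FP F (fsubset_refl _); have /= h2 := FP G FG.
move: h1 h2; set u := \sum_(_ <- F) _; set v := \sum_(_ <- G) _ => h1 h2.
have -> : u - v = (z - v) - (z - u) by rewrite opprB [RHS]addrC subrKA.
by rewrite (le_lt_trans (ler_normB _ _))//; lra.
Qed.

Lemma powR_le_cancel (R : realType) (p a b : R) : 0 < p -> 0 <= a -> 0 <= b ->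
  a `^ p <= b `^ p -> a <= b.
Proof.
move=> p0 a0 b0; apply: contraTT; rewrite -!ltNge => ba.
by rewrite gt0_ltr_powR// nnegrE.
Qed.

Section lp_norm_theory.
Context {R : realType} {p : R} {p1 : 1 <= p} {X : normedModType R}.
Local Notation L := (lp p1 X).
Implicit Types (x y z : L).

Let p0 : 0 < p. Proof. exact: lt_le_trans ltr01 p1. Qed.

Lemma lp_norm_powE z : (`|z| `^ p)%:E = lp_sum p z.
Proof.
rewrite -[ `|z| ]/(lp_norm z) /lp_norm /lp_normf -powRrM mulVf ?gt_eqF//.
by rewrite powRr1 ?fineK ?lp_fin_num// fine_ge0// lp_sum_ge0.
Qed.

Lemma lp_partial_sum_le z n : \sum_(0 <= k < n) `|z k| `^ p <= `|z| `^ p.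
Proof.
rewrite -lee_fin lp_norm_powE -sumEFin /lp_sum.
by apply: nneseries_lim_ge => k _ _; rewrite lee_fin powR_ge0.
Qed.

Lemma lp_norm_pow_le z (M : R) :
  (forall n, \sum_(0 <= k < n) `|z k| `^ p <= M) -> `|z| `^ p <= M.
Proof.
move=> zM; rewrite -lee_fin lp_norm_powE /lp_sum; apply: lime_le.
  by apply: is_cvg_nneseries => k _ _; rewrite lee_fin powR_ge0.
by apply: nearW => n; rewrite sumEFin lee_fin.
Qed.

Lemma lp_norm_component z k : `|z k| <= `|z|.
Proof.
have h : `|z k| `^ p <= `|z| `^ p.
  apply: le_trans (lp_partial_sum_le z k.+1).
  by rewrite big_nat_recr//= lerDr sumr_ge0// => i _; rewrite powR_ge0.
exact: (powR_le_cancel p0 (normr_ge0 _) (normr_ge0 _) h).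
Qed.

Lemma lp_norm_le x y : (forall k, `|x k| <= `|y k|) -> `|x| <= `|y|.
Proof.
move=> xy; have h : `|x| `^ p <= `|y| `^ p.
  apply: lp_norm_pow_le => n; apply: le_trans (lp_partial_sum_le y n).
  by apply: ler_sum => k _; rewrite ge0_ler_powR ?nnegrE// ltW.
exact: (powR_le_cancel p0 (normr_ge0 _) (normr_ge0 _) h).
Qed.

Lemma lpD x y k : (x + y) k = x k + y k. Proof. by []. Qed.
Lemma lpN x k : (- x) k = - x k. Proof. by []. Qed.
Lemma lpZ a x k : (a *: x) k = a *: x k. Proof. by []. Qed.

Lemma lp_bigsum (I : Type) (s : seq I) (F : I -> L) k :
  (\sum_(i <- s) F i) k = \sum_(i <- s) F i k.
Proof. by elim: s => [|i s IH]; rewrite ?big_nil// !big_cons lpD IH. Qed.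

Lemma lp_ext x y : (forall k, x k = y k) -> x = y.
Proof. by move=> xy; apply/val_inj/funext. Qed.

Lemma lp_singleE i (u : X) k : lp_single p1 i u k = if k == i then u else 0.
Proof. by []. Qed.

Definition lp_trunc n z : L := \sum_(0 <= k < n) lp_single p1 k (z k).

Lemma lp_truncE n z k : lp_trunc n z k = if (k < n)%N then z k else 0.
Proof.
rewrite lp_bigsum; case: ifPn => kn.
  rewrite (bigD1_seq k) ?mem_index_iota ?iota_uniq// lp_singleE eqxx.
  rewrite big1 => [|i ik]; first exact: addr0.
  by rewrite lp_singleE eq_sym (negPf ik).
rewrite big_seq big1// => i; rewrite mem_index_iota/= => i_n.
case: eqVneq => // ki.
by move: i_n kn; rewrite ki => ->.
Qed.

Lemma norm_lp_single i (u : X) : `|lp_single p1 i u| = `|u|.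
Proof.
apply/le_anti/andP; split; last first.
  by have := lp_norm_component (lp_single p1 i u) i; rewrite lp_singleE eqxx.
have h : `|lp_single p1 i u| `^ p <= `|u| `^ p.
  apply: lp_norm_pow_le => n.
  have [ni|i_n] := leqP n i.
    rewrite big_seq big1 ?powR_ge0// => k; rewrite mem_index_iota/= => kn.
    by rewrite ltn_eqF ?(leq_trans kn)// normr0 powR0// gt_eqF.
  rewrite (bigD1_seq i) ?mem_index_iota ?iota_uniq// lp_singleE eqxx.
  rewrite big1 => [|k /negPf ki]; first by rewrite /= addr0.
  by rewrite lp_singleE ki normr0 powR0// gt_eqF.
exact: (powR_le_cancel p0 (normr_ge0 _) (normr_ge0 _) h).
Qed.

Lemma lp_tail_small z (eps : R) : 0 < eps ->
  exists n, `|z - lp_trunc n z| < eps.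
Proof.
move=> eps0; have ep0 : 0 < eps `^ p by rewrite powR_gt0.
have [n nP] : exists n, `|z| `^ p - eps `^ p < \sum_(0 <= k < n) `|z k| `^ p.
  apply: contrapT => h.
  have : `|z| `^ p <= `|z| `^ p - eps `^ p.
    by apply: lp_norm_pow_le => n; rewrite leNgt; apply/negP => hn; apply: h; exists n.
  by lra.
exists n; rewrite ltNge; apply/negP => hle.
suff : `|z - lp_trunc n z| `^ p <= `|z| `^ p - \sum_(0 <= k < n) `|z k| `^ p.
  have : eps `^ p <= `|z - lp_trunc n z| `^ p.
    by rewrite ge0_ler_powR ?nnegrE// ltW.
  move=> /le_trans h /h; rewrite lerBrDr addrC -lerBrDr leNgt.
  by rewrite nP.
have wE k : (z - lp_trunc n z) k = if (k < n)%N then 0 else z k.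
  by rewrite lpD lpN lp_truncE; case: ifPn => _; rewrite ?subrr ?subr0.
move: (z - _) wE {hle} => w wE.
apply: lp_norm_pow_le => m; rewrite lerBrDr.
apply: le_trans (lp_partial_sum_le z (n + m)).
rewrite [X in _ <= X](big_cat_nat (n := n))/= ?leq_addr// [X in X <= _]addrC lerD2l.
have w0 k : (k < n)%N -> `|w k| `^ p = 0.
  by move=> kn; rewrite wE kn normr0 powR0// gt_eqF.
have [mn|nm] := leqP m n.
  rewrite big_nat big1 ?sumr_ge0// => k /andP[_ km].
  by rewrite w0// (leq_trans km).
rewrite (big_cat_nat (n := n))/= ?(ltnW nm)//.
rewrite big_nat big1 ?add0r => [|k /andP[_ /w0]//].
rewrite [X in _ <= X](big_cat_nat (n := m))/= ?leq_addl ?(ltnW nm)//.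
rewrite ler_wpDr ?sumr_ge0//.
rewrite le_eqVlt; apply/orP; left; apply/eqP/eq_big_nat => k /andP[nk _].
by rewrite wE ltnNge nk.
Qed.

Lemma lp_norm_head_tail z n :
  `|z| <= \sum_(0 <= k < n) `|z k| + `|z - lp_trunc n z|.
Proof.
rewrite -[X in `|X| <= _](subrK (lp_trunc n z)) addrC.
rewrite (le_trans (ler_normD _ _))// lerD2r (le_trans (ler_norm_sum _ _ _))//.
by apply: ler_sum => k _; rewrite norm_lp_single.
Qed.

End lp_norm_theory.

(** * The basis of l_p(X) *)

Section lp_basis_theory.
Context {R : realType} {p : R} {p1 : 1 <= p} {X : normedModType R}.
Context {J : countType} (e : J -> X).
Hypothesis e_basis : one_unconditional_basis e.
Hypothesis e_signs : sign_changes e.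
Local Notation L := (lp p1 X).
Local Notation E := (lp_basis p1 e).
Local Notation coord := (Defs.coord e).
Implicit Types (x y z : L).

Lemma coord_lp_sum (F : {fset nat * J}) (a : nat * J -> R) k j :
  coord ((\sum_(i <- F) a i *: E i) k) j = if (k, j) \in F then a (k, j) else 0.
Proof.
have coord_E i : coord ((a i *: E i) k) j = a i * ((k, j) == i)%:R.
  rewrite lpZ coordZ//; congr (_ * _); case: i => k' j'.
  rewrite lp_singleE xpair_eqE/=.
  by case: eqVneq => /= _; [rewrite coord_basis|rewrite coord0].
rewrite lp_bigsum coord_sum// (eq_bigr _ (fun i _ => coord_E i)).
case: ifPn => kjF.
  rewrite (bigD1_seq (k, j))//= ?fset_uniq// eqxx mulr1.
  by rewrite big1 ?addr0// => i ik; rewrite eq_sym (negPf ik) mulr0.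
rewrite big_seq big1// => i iF.
by case: eqVneq iF kjF => [->->|]//; rewrite mulr0.
Qed.

(** The first [n] components are approximated one by one by finite sums. On the others the remainder
    is a restriction of [z], so it is dominated by the tail of [z]. *)
Lemma lp_has_expansion z :
  has_expansion E (fun i => coord (z i.1) i.2) z.
Proof.
apply/cvg_partial_sumP => eps eps0.
have [n ntail] := lp_tail_small z (divr_gt0 eps0 (ltr0n R 2)).
(* The [n] head components share the error [eps / 2]; the successor covers the case where [n] is
   0. *)
have d0 : 0 < eps / 2 / n.+1%:R by rewrite !divr_gt0.
pose S (G : {fset nat * J}) : L := \sum_(i <- G) coord (z i.1) i.2 *: E i.
have SE G k : z k - S G k = restr e_signs [set j | (k, j) \notin G] (z k).
  apply: (coord_inj e_basis); apply/funext => j.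
  rewrite coordB// coord_lp_sum coord_restr//.
  case: (boolP ((k, j) \in G)) => kjG; last by rewrite mem_set// subr0.
  by rewrite memNset ?subrr//=; apply/negP; rewrite negbK.
have [F FP] : exists F : {fset nat * J}, forall G : {fset nat * J},
    (F `<=` G)%fset -> forall k, (k < n)%N -> `|z k - S G k| < eps / 2 / n.+1%:R.
  have : forall m, exists F : {fset nat * J}, forall G : {fset nat * J},
      (F `<=` G)%fset -> forall k, (k < m)%N -> `|z k - S G k| < eps / 2 / n.+1%:R.
    elim=> [|m [F FP]]; first by exists fset0.
    have [H HP] := restr_small e_basis e_signs (z m) d0.
    exists (F `|` [fset (m, j) | j in H])%fset => G.
    rewrite fsubUset => /andP[FG HG] k; rewrite ltnS leq_eqVlt => /predU1P[->|km].
      rewrite SE; apply: HP => j jH /= /negP; case.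
      by apply: (fsubsetP HG); apply/imfsetP; exists j.
    exact: FP.
  by move=> /(_ n).
exists F => G FG; rewrite -/(S G).
apply: (le_lt_trans (lp_norm_head_tail _ n)).
have : `|z - S G - lp_trunc n (z - S G)| <= `|z - lp_trunc n z|.
  apply: lp_norm_le => k; rewrite !lpD !lpN !lp_truncE; case: ifPn => _.
    by rewrite !subrr.
  by rewrite !subr0 SE norm_restr_le.
have : \sum_(0 <= k < n) `|(z - S G) k| <= eps / 2.
  apply: (@le_trans _ _ (\sum_(0 <= k < n) eps / 2 / n.+1%:R)).
    by apply: ler_sum_nat => k /andP[_ kn]; apply: ltW; exact: FP.
  rewrite sumr_const_nat subn0 -(mulr_natr _ n) mulrAC ler_pdivrMr//.
  by rewrite ler_wpM2l ?ler_nat// ltW// divr_gt0.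
move=> h1 h2; apply: le_lt_trans (lerD h1 h2) _.
by rewrite [ltRHS](splitr eps) ltrD2l; exact: ntail.
Qed.

Lemma lp_basis_one_unconditional : one_unconditional_basis E.
Proof.
split=> [z|F a s].
  exists (fun i => coord (z i.1) i.2); split; first exact: lp_has_expansion.
  move=> a /cvg_partial_sumP az; apply/funext => -[k j] /=.
  apply/eqP; rewrite -subr_eq0; apply/eqP.
  apply: (@eq0_le_eps _ R^o `|e j|^-1) => eps eps0.
  have [F FP] := az eps eps0.
  have := FP (F `|` [fset (k, j)])%fset (fsubsetUl _ _).
  set w := \sum_(_ <- _) _ => zw.
  have -> : coord (z k) j - a (k, j) = coord (z k - w k) j.
    by rewrite coordB// coord_lp_sum !inE eqxx orbT.
  rewrite mulrC ler_pdivlMr ?normr_gt0 ?basis_neq0//.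
  apply: le_trans (norm_coord_basis e_basis _ _) _.
  exact: le_trans (lp_norm_component (z - w) k) (ltW zw).
apply: lp_norm_le => k.
rewrite (_ : lp_fun _ k = flip e_signs (fun j => s (k, j))
  ((\sum_(i <- F) a i *: E i) k)); first exact: norm_flip_le.
apply: (coord_inj e_basis); apply/funext => j.
by rewrite coord_flip// !coord_lp_sum; case: ifPn; rewrite ?mulr0.
Qed.

Lemma coord_lp z i : Defs.coord E z i = coord (z i.1) i.2.
Proof. by rewrite (coord_eq lp_basis_one_unconditional (@lp_has_expansion z)). Qed.

Lemma lp_basis_signs : sign_changes E.
Proof.
move=> s z.
pose f k := flip e_signs (fun j => s (k, j)) (z k).
have fL : f \in @lp_pred R p X p1.
  apply/asboolP; apply: (@le_lt_trans _ _ (lp_sum p z)).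
    by apply: lp_sum_le => // k; exact: norm_flip_le.
  by rewrite -lp_norm_powE ltry.
exists (Lp fL); apply/funext => -[k j].
by rewrite !coord_lp coord_flip.
Qed.

End lp_basis_theory.

(** * Convexity and second order expansions *)

Section powR_convexity.
Context {R : realType}.
Implicit Types a t q p : R.

(* Young's inequality for t and a^(q - 1). *)
Lemma powR_tangent q a t : 1 < q -> 0 < a -> 0 <= t ->
  a `^ q + q * a `^ (q - 1) * (t - a) <= t `^ q.
Proof.
move=> q1 a0 t0; have q0 : 0 < q by lra.
have r0 : 0 < q - 1 by lra.
have := @conjugate_powR R t (a `^ (q - 1)) q (q / (q - 1)) t0 (powR_ge0 _ _) q0
  (divr_gt0 q0 r0).
rewrite -powRrM [(q - 1) * _]mulrC divfK ?gt_eqF//.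
have -> : a `^ q = a * a `^ (q - 1).
  by rewrite -{2}(powRr1 (ltW a0)) -powRD ?(gt_eqF a0) ?implybT// addrC subrK.
set b := a `^ (q - 1); set c := t `^ q => H.
have : t * b <= c / q + a * b / (q / (q - 1)).
  by apply: H; field; rewrite !gt_eqF.
rewrite -(ler_pM2l q0) => h.
have e1 : q * (c / q + a * b / (q / (q - 1))) = c + a * b * (q - 1).
  by field; rewrite !gt_eqF.
by move: h; rewrite e1; lra.
Qed.

(** The tangent inequality for the exponent [p / 2], which exceeds 1, between the squares of [a] and
    [t]. The squares later give control of first order variations of the norm. *)
Lemma powR_quadratic p a t : 2 < p -> 0 < a -> 0 <= t ->
  a `^ p + p / 2 * (a ^+ 2) `^ (p / 2 - 1) * (t ^+ 2 - a ^+ 2) <= t `^ p.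
Proof.
move=> p2 a0 t0.
have sq s : 0 <= s -> s `^ p = (s ^+ 2) `^ (p / 2).
  by move=> s0; rewrite -(powR_mulrn 2 s0) -powRrM mulrC divfK.
rewrite !sq// ?(ltW a0)//; apply: powR_tangent; last exact: sqr_ge0.
  by rewrite ltr_pdivlMr// mul1r.
exact: exprn_gt0.
Qed.

(** Add the tangent inequalities at the norm of [u]; the linear terms have nonnegative sum by the
    triangle inequality. *)
Lemma powR_midpoint (X : normedModType R) p (u v : X) : 1 < p ->
  `|u| `^ p *+ 2 <= `|u + v| `^ p + `|u - v| `^ p.
Proof.
move=> p1; have [->|u0] := eqVneq u 0.
  by rewrite normr0 powR0 ?gt_eqF ?mul0rn ?addr_ge0 ?powR_ge0//; lra.
have n0 : 0 < `|u| by rewrite normr_gt0.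
have h1 := powR_tangent p1 n0 (normr_ge0 (u + v)).
have h2 := powR_tangent p1 n0 (normr_ge0 (u - v)).
have : 0 <= p * `|u| `^ (p - 1) * (`|u + v| + `|u - v| - `|u| - `|u|).
  rewrite !mulr_ge0 ?powR_ge0//; first lra.
  have := ler_normD (u + v) (u - v).
  rewrite addrACA subrr addr0 -mulr2n normrMn mulr2n; lra.
by move: h1 h2; rewrite mulr2n; lra.
Qed.

End powR_convexity.

(** * Second order behaviour of real functions at 0 *)

Section second_order.
Context {R : realType}.
Implicit Types (N : R -> R) (eps delta t : R).

Lemma derive1_quotient_limit (f : R -> R) x : derivable f x 1 ->
  forall eps, 0 < eps -> exists2 delta, 0 < delta & forall h, `|h| < delta ->
    `|f (x + h) - f x - derive1 f x * h| <= eps * `|h|.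
Proof.
move=> df eps eps0.
have : (fun h => h^-1 *: ((f \o shift x) (h *: 1) - f x)) @ 0^' --> derive1 f x.
  by rewrite derive1E; exact: df.
move=> /cvgrPdist_le /(_ _ eps0)[delta /= delta0 H]; exists delta => // h hd.
have [->|h0] := eqVneq h 0.
  by rewrite addr0 subrr mulr0 subrr normr0 mulr0.
have := H h; rewrite /ball_ /= sub0r normrN hd => /(_ isT h0).
rewrite /GRing.scale/= mulr1 => H1.
rewrite -ler_pdivrMr ?normr_gt0// -normfV -normrM.
rewrite -normrN (le_trans _ H1)// le_eqVlt; apply/orP; left; apply/eqP.
by congr `| _ |; rewrite [h + x]addrC; field.
Qed.

(** The mean value theorem for [N] minus its quadratic term, whose derivative is o(s) by the
    definition of the second derivative at 0 alone. *)
Lemma taylor2 N : (forall t, derivable N t 1) -> derive1 N 0 = 0 ->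
  derivable (derive1 N) 0 1 ->
  forall eps, 0 < eps -> exists2 delta, 0 < delta & forall t, `|t| < delta ->
    `|N t - N 0 - derive1 (derive1 N) 0 / 2 * t ^+ 2| <= eps * t ^+ 2.
Proof.
move=> dN N0 ddN eps eps0; set c : R := derive1 (derive1 N) 0.
have [delta delta0 H] := derive1_quotient_limit ddN eps0.
exists delta => // t td.
pose M (s : R) : R := N s - c / 2 * s ^+ 2.
pose dM (s : R) : R := derive1 N s - c * s.
have MdM (s : R) : is_derive s (1 : R) M (dM s).
  rewrite /M /dM derive1E; apply: is_deriveB.
    by apply: DeriveDef => //; exact: dN.
  have -> : c * s = c / 2 * (s *+ 2) by rewrite -mulr_natr; field.
  apply: is_deriveZ; apply: (is_derive_eq (is_deriveX 1 _)).
  by rewrite /GRing.scale/= expr0 !mulr1 mul1r mulr2n.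
have dM_le s : `|s| <= `|t| -> `|dM s| <= eps * `|t|.
  move=> st; have := H s (le_lt_trans st td).
  rewrite add0r N0 subr0 -/c => /le_trans; apply.
  by rewrite ler_wpM2l// ltW.
have Mcont (a b : R) : {within `[a, b], continuous M}.
  apply: derivable_within_continuous => x _.
  by have [] := MdM x.
suff [s st ->] : exists2 s, `|s| <= `|t| &
    N t - N 0 - c / 2 * t ^+ 2 = dM s * t.
  by rewrite normrM -(real_normK (num_real t)) expr2 mulrA ler_wpM2r// dM_le.
have -> : N t - N 0 - c / 2 * t ^+ 2 = M t - M 0.
  by rewrite /M expr0n/= mulr0 subr0 addrAC.
have [t0|t0|->] := ltgtP t 0.
- have [s sI sE] := MVT t0 (fun x _ => MdM x) (Mcont _ _).
  exists s; last by apply: oppr_inj; rewrite opprB sE sub0r mulrN.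
  move: sI; rewrite in_itv/= => /andP[ts s0].
  by rewrite !ler0_norm ?(ltW t0) ?(ltW s0)// lerN2 ltW.
- have [s sI sE] := MVT t0 (fun x _ => MdM x) (Mcont _ _).
  exists s; last by rewrite sE subr0.
  move: sI; rewrite in_itv/= => /andP[s0 st].
  by rewrite !ger0_norm ?(ltW t0) ?(ltW s0)// ltW.
- by exists 0 => //; rewrite subrr mulr0.
Qed.

Lemma eq0_le_mul_eps (K a : R) : (forall eps, 0 < eps -> `|a| <= K * eps) -> a = 0.
Proof. exact: (@eq0_le_eps R R^o). Qed.

Lemma second_difference_vanish N : (forall t, derivable N t 1) ->
  derivable (derive1 N) 0 1 ->
  (forall t, 0 <= N t + N (- t) - N 0 *+ 2) ->
  (forall eps, 0 < eps -> exists2 delta, 0 < delta & forall t, `|t| < delta ->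
     N t + N (- t) - N 0 *+ 2 <= eps * t ^+ 2 /\
     (N t - N 0) ^+ 2 <= eps * t ^+ 2) ->
  derive1 N 0 = 0 /\ derive1 (derive1 N) 0 = 0.
Proof.
move=> dN ddN cN sN.
have half_pos (d : R) : 0 < d -> 0 < `|d / 2| < d.
  by move=> d0; rewrite gtr0_norm; lra.
have N0 : derive1 N 0 = 0.
  apply: (@eq0_le_mul_eps 2) => eps eps0.
  have [d1 d10 H1] := derive1_quotient_limit (dN 0) eps0.
  (* The hypothesis bounds the square of the increment, so [eps ^+ 2] yields an increment of at most
     [eps * |h|]. *)
  have [d2 d20 H2] := sN (eps ^+ 2) (exprn_gt0 2 eps0).
  have m0 : 0 < Num.min d1 d2 by rewrite lt_min d10.
  set h := Num.min d1 d2 / 2; have /andP[h0] := half_pos _ m0.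
  rewrite -/h lt_min => /andP[/H1 h1 /H2[_ h2]].
  move: h1; rewrite add0r => h1.
  have {}h2 : `|N h - N 0| <= eps * `|h|.
    rewrite -(@ler_pXn2r _ 2) ?nnegrE ?mulr_ge0 ?(ltW eps0)//.
    by rewrite real_normK ?num_real// exprMn real_normK ?num_real.
  rewrite -(ler_pM2r h0) -normrM -mulrA mulr_natl mulr2n.
  have -> : derive1 N 0 * h = (N h - N 0) - (N h - N 0 - derive1 N 0 * h).
    by rewrite opprB addrC subrK.
  by rewrite (le_trans (ler_normB _ _))// lerD.
split=> //; apply: (@eq0_le_mul_eps 3) => eps eps0.
(* The expansions at [h] and [- h] contribute one [eps] each and the second difference a third,
   whence the constant 3. *)
have [d1 d10 H1] := taylor2 dN N0 ddN eps0.
have [d2 d20 H2] := sN eps eps0.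
have m0 : 0 < Num.min d1 d2 by rewrite lt_min d10.
set h := Num.min d1 d2 / 2; have /andP[h0] := half_pos _ m0.
rewrite -/h lt_min => /andP[hd1 /H2[h2 _]].
have := H1 h hd1; have := H1 (- h); rewrite normrN => /(_ hd1).
rewrite sqrrN; set L : R := derive1 _ 0; have := cN h; move: h2.
rewrite !ler_norml mulr2n.
have hh : 0 < h ^+ 2 by rewrite -real_normK ?num_real// exprn_gt0.
move: (h ^+ 2) hh => H hh; move=> A B /andP[C1 C2] /andP[D1 D2].
have l1 : L * H <= (3 * eps) * H by lra.
have l2 : - (3 * eps) * H <= L * H by lra.
by move: l1 l2; rewrite !(ler_pM2r hh) => -> ->.
Qed.

Lemma vanishes_along_full_measure N A : full_measure_in01 A ->
  snd_derivative_vanishes_along N A ->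
  {for 0, continuous (derive1 (derive1 N))} -> derive1 (derive1 N) 0 = 0.
Proof.
move=> [A01 An] [_ N0] cN; apply: (@eq0_le_mul_eps 2) => eps eps0.
move/cvgrPdist_le : cN => /(_ _ eps0)[d1 /= d10 H1].
move/cvgrPdist_le : N0 => /(_ _ eps0)[d2 /= d20 H2].
set d : R := Num.min 1 (Num.min d1 d2).
have d0 : 0 < d by rewrite !lt_min ltr01 d10.
(* A set of full measure in [0, 1] meets every interval ]0, d[, which has positive measure. *)
have [t At /andP[t0 td]] : exists2 t, A t & 0 < t < d.
  apply: contrapT => nA.
  have dA : `]0, d[ `<=` `[0, 1]%classic `\` A.
    move=> t /=; rewrite in_itv/= => /andP[t0 td]; split; last first.
      by move=> At; apply: nA; exists t => //; rewrite t0.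
    rewrite /= in_itv/= (ltW t0)/=; move: td; rewrite lt_min => /andP[/ltW //].
  have : (@lebesgue_measure R).-negligible `]0%R, d[%classic.
    by apply: negligibleS An; exact: dA.
  move/negligibleP => /(_ (measurable_itv _)).
  move=> /(eq_trans (esym (lebesgue_measure_itv `]0%R, d[))).
  by rewrite /= lte_fin d0 oppr0 adde0 => /eqP; rewrite eqe gt_eqF.
have tn : `|t| = t by rewrite gtr0_norm.
have h1 : `|derive1 (derive1 N) 0 - derive1 (derive1 N) t| <= eps.
  apply: H1; rewrite /ball_ /= sub0r normrN tn.
  by move: td; rewrite !lt_min => /and3P[].
have h2 : `|0 - derive1 (derive1 N) t| <= eps.
  apply: H2 => //; last by rewrite gt_eqF.
  rewrite /ball_ /= sub0r normrN tn.
  by move: td; rewrite !lt_min => /and3P[].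
have -> : derive1 (derive1 N) 0 = (derive1 (derive1 N) 0 - derive1 (derive1 N) t)
    - (0 - derive1 (derive1 N) t) by rewrite sub0r opprK subrK.
by rewrite (le_trans (ler_normB _ _))// mulr_natl mulr2n lerD.
Qed.

Lemma vanishes_along_01 N : (forall t, derivable (derive1 N) t 1) ->
  {for 0, continuous (derive1 (derive1 N))} -> derive1 (derive1 N) 0 = 0 ->
  snd_derivative_vanishes_along N `[0, 1].
Proof.
move=> dN cN N0; split=> [t _|]; first exact: dN.
apply/cvgrPdist_le => eps eps0.
move/cvgrPdist_le : cN => /(_ _ eps0); rewrite N0 => -[d /= d0 H].
by exists d => //= t td _ _; exact: H.
Qed.

Lemma full_measure_01 : full_measure_in01 (`[0, 1]%classic : set R).
Proof. by split=> //; rewrite setDv; exact: negligible_set0. Qed.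

End second_order.

(** * Derivatives of the norm along lines avoiding 0 *)

Section derivatives_along_lines.
Context {R : realType} {V W : normedModType R}.

Lemma bop_eval_continuous (y : V) : continuous (fun b : bop V W => b y).
Proof.
move=> b; have Fb : Filter (nbhs b) by exact: nbhs_filter.
apply/(cvgrPdist_lt (FF := Fb)) => eps eps0.
have M0 : 0 < `|y| + 1 by rewrite ltr_wpDl.
near=> c; apply: (@le_lt_trans _ _ (`|b - c| * `|y|)).
  exact: (opnorm_ge (b - c) y).
have : `|b - c| < eps / (`|y| + 1).
  by near: c; apply: cvgr_dist_lt; rewrite ?divr_gt0//; exact: cvg_id.
rewrite ltr_pdivlMr//; apply: le_lt_trans.
by rewrite ler_wpM2l// lerDl.
Unshelve. all: by end_near. Qed.

Lemma is_derive_line (f : V -> W) x y (t : R) :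
  differentiable f (x + t *: y) ->
  is_derive t (1 : R) (fun s : R => f (x + s *: y)) (Dop f (x + t *: y) y).
Proof.
move=> df; pose h (s : R) := x + s *: y.
have dh : is_diff t h ( *:%R ^~ y).
  by apply: is_diff_eq; rewrite add0r.
have dfh : differentiable (f \o h) t.
  by apply: differentiable_comp.
apply: DeriveDef; first exact: diff_derivable.
rewrite deriveE// (_ : (fun s => _) = f \o h)// diff_comp//= diff_val.
by rewrite DopE// scale1r.
Qed.

Lemma is_derive_eval (g : R -> bop V W) (t : R) (G : bop V W) y :
  is_derive t (1 : R) g G -> is_derive t (1 : R) (fun s => g s y : W) (G y).
Proof.
move=> [dg gG].
have H : (fun h => h^-1 *: ((g \o shift t) (h *: 1) - g t)) @ 0^' --> G.
  by rewrite -gG; exact: dg.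
have {}H : (fun h => h^-1 *: (((fun s => g s y) \o shift t) (h *: 1) - g t y))
    @ 0^' --> G y.
  exact: (continuous_cvg _ (@bop_eval_continuous y G) H).
apply: DeriveDef; first by apply/cvg_ex; exists (G y); exact: H.
exact: cvg_lim H.
Qed.

End derivatives_along_lines.

Section norm_along_lines.
Context {R : realType} {X : normedModType R}.
Hypothesis X_C2 : C2_smooth X.
Variables x y : X.
Hypothesis xy : ~ exists c : R, x = c *: y.
Let N (t : R) : R := `|x + t *: y|.

Let line_neq0 (t : R) : x + t *: y != 0.
Proof.
apply/eqP => /eqP; rewrite addr_eq0 => /eqP xE.
by apply: xy; exists (- t); rewrite scaleNr.
Qed.

Let N1 (t : R) : derive1 N t = Dop (@normf R X) (x + t *: y) y.
Proof.
have [d _ _] := X_C2 (line_neq0 t).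
by rewrite derive1E; have [_ ->] := is_derive_line d.
Qed.

Let dN1 (t : R) : is_derive t (1 : R) (derive1 N)
  (Dop (Dop (@normf R X)) (x + t *: y) y y).
Proof.
rewrite (_ : derive1 N = fun t => Dop (@normf R X) (x + t *: y) y); last first.
  by apply/funext.
have [_ d _] := X_C2 (line_neq0 t).
exact/is_derive_eval/is_derive_line.
Qed.

Lemma norm_line_derivable (t : R) : derivable N t 1.
Proof.
have [d _ _] := X_C2 (line_neq0 t).
by have [] := is_derive_line d.
Qed.

Lemma norm_line_derivable2 (t : R) : derivable (derive1 N) t 1.
Proof. by have [] := dN1 t. Qed.

Lemma norm_line_continuous2 : continuous (derive1 (derive1 N)).
Proof.
rewrite (_ : derive1 (derive1 N) = fun t => Dop (Dop (@normf R X)) (x + t *: y) y y).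
  move=> t; have [_ _ c] := X_C2 (line_neq0 t).
  pose h (s : R) := x + s *: y.
  have hc : {for t, continuous h}.
    by apply: cvgD; [exact: cvg_cst|apply: cvgZr_tmp; exact: cvg_id].
  have := continuous_comp hc c => {}c.
  have := continuous_comp c (@bop_eval_continuous _ _ _ y _) => {}c.
  exact: (continuous_comp c (@bop_eval_continuous _ _ _ y _)).
by apply/funext => t; rewrite derive1E; have [_ ->] := dN1 t.
Qed.

End norm_along_lines.

(** * Second order characterization of disjointness *)

(* F(t) <= o(t^2) at 0; F may be very negative. *)
Definition small_square {R : realType} (F : R -> R) :=
  forall eps : R, 0 < eps -> exists2 delta : R, 0 < delta &
    forall t : R, `|t| < delta -> F t <= eps * t ^+ 2.

Lemma small_square_le (R : realType) (c : R) (F G : R -> R) : 0 < c ->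
  (forall t, F t <= c * G t) -> small_square G -> small_square F.
Proof.
move=> c0 FG sG eps eps0; have [d d0 dG] := sG _ (divr_gt0 eps0 c0).
exists d => // t /dG h; apply: le_trans (FG t) _.
by rewrite -ler_pdivlMl// mulrA [c^-1 * _]mulrC.
Qed.

(** Powers of the norm are used because in l_p(X) they add up over the components. *)
Definition second_difference {R : realType} {Z : normedModType R} (p : R)
  (x y : Z) (t : R) : R :=
  `|x + t *: y| `^ p + `|x - t *: y| `^ p - `|x| `^ p *+ 2.

Lemma second_difference_ge0 (R : realType) (Z : normedModType R) (p : R)
  (x y : Z) (t : R) : 1 < p -> 0 <= second_difference p x y t.
Proof. by move=> p1; rewrite subr_ge0 powR_midpoint. Qed.

Section base_space.
Context {R : realType} {p : R} {X : normedModType R} {J : countType} {e : J -> X}.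
Hypothesis p2 : 2 < p.
Hypothesis e_basis : one_unconditional_basis e.
Hypothesis e_signs : sign_changes e.
Hypothesis X_C2 : C2_smooth X.
Hypothesis X_reflects : reflects_disjointness e.
Local Notation coord := (Defs.coord e).

(** By clause (iii) and the continuity of the second derivative, both derivatives vanish at 0, so
    [taylor2] has no quadratic term. *)
Lemma norm_add_disjoint_basis (x : X) j : x != 0 -> coord x j = 0 ->
  small_square (fun t => `|x + t *: e j| - `|x|).
Proof.
move=> x0 xj eps eps0.
have nspan : ~ exists c : R, x = c *: e j.
  move=> [c xE]; move/eqP : x0; apply; rewrite xE.
  by move: xj; rewrite xE coordZ// coord_basis// eqxx mulr1 => ->; rewrite scale0r.
have [_ _ []] := X_reflects nspan.
- apply/(disjoint_inP e_basis e_signs) => i; rewrite coord_basis//.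
  by have [->|_] := eqVneq i j; [left|right].
- apply: (@sub_finite_set _ _ [set j]); last exact: finite_set1.
  move=> i; rewrite /Defs.support /= coord_basis//.
  by have [->//|_] := eqVneq i j; rewrite eqxx.
move=> N0 [A A01 AN].
have N2 := vanishes_along_full_measure A01 AN
  (@norm_line_continuous2 _ _ X_C2 _ _ nspan 0).
have [d d0 H] := taylor2 (@norm_line_derivable _ _ X_C2 _ _ nspan) N0
  (@norm_line_derivable2 _ _ X_C2 _ _ nspan 0) eps0.
exists d => // t td; have := H t td.
rewrite N2 mul0r mul0r subr0 scale0r addr0.
exact/le_trans/ler_norm.
Qed.

Lemma norm_pow_add_disjoint_basis (x : X) j : coord x j = 0 ->
  small_square (fun t => `|x + t *: e j| `^ p - `|x| `^ p).
Proof.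
have p0 : 0 < p by move: p2; lra.
have pp0 : 0 < p - 2 by move: p2; lra.
move=> xj eps eps0; have [->|x0] := eqVneq x 0.
  set M := `|e j| `^ p; have M0 : 0 < M + 1 by rewrite ltr_wpDl ?powR_ge0.
  have epsM : 0 < eps / (M + 1) by rewrite divr_gt0.
  (* For [x = 0] the left side is [M * |t|]^ p[, and the factor]|t| [^ (p - 2)] is small because [p]
     exceeds 2. *)
  exists ((eps / (M + 1)) `^ (p - 2)^-1); first by rewrite powR_gt0.
  move=> t td; rewrite normr0 powR0 ?gt_eqF// subr0 add0r normrZ powRM// -/M.
  have -> : `|t| `^ p = t ^+ 2 * `|t| `^ (p - 2).
    have [->|t0] := eqVneq t 0; first by rewrite normr0 powR0 ?gt_eqF// expr0n mul0r.
    rewrite -[t ^+ 2]real_normK ?num_real// -(powR_mulrn 2)// -powRD.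
      by congr (_ `^ _); rewrite addrC subrK.
    by rewrite normr_eq0 (negPf t0) implybT.
  rewrite -mulrA mulrC ler_wpM2r ?sqr_ge0//.
  have : `|t| `^ (p - 2) <= eps / (M + 1).
    have -> : eps / (M + 1) = ((eps / (M + 1)) `^ (p - 2)^-1) `^ (p - 2).
      by rewrite -powRrM mulVf ?gt_eqF// powRr1// ltW.
    by apply: ge0_ler_powR; rewrite ?nnegrE ?powR_ge0 ?(ltW pp0)// ltW.
  rewrite ler_pdivlMr//; apply: le_trans.
  by rewrite ler_wpM2l ?powR_ge0// lerDl.
have a0 : 0 < `|x| by rewrite normr_gt0.
set a := `|x| in a0 *.
have B0 : 0 < p * (a + 1) `^ (p - 1) by rewrite mulr_gt0// powR_gt0// ltr_wpDr.
have eps'0 : 0 < Num.min 1 (eps / (p * (a + 1) `^ (p - 1))).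
  by rewrite lt_min ltr01 divr_gt0.
have [d d0 H] := norm_add_disjoint_basis x0 xj eps'0.
exists (Num.min 1 d); first by rewrite lt_min ltr01.
move=> t; rewrite lt_min => /andP[t1 /H].
set eps' := Num.min 1 _ in eps'0 * => h.
set s := eps' * t ^+ 2 in h.
have s0 : 0 <= s by rewrite mulr_ge0 ?sqr_ge0// ltW.
have s1 : s <= 1.
  rewrite mulr_ile1 ?sqr_ge0 ?(ltW eps'0)//; first by rewrite ge_min lexx.
  by rewrite -real_normK ?num_real// exprn_ile1// ltW.
have as0 : 0 < a + s by rewrite ltr_wpDr.
have p1 : 1 < p by move: p2; lra.
have := powR_tangent p1 as0 (ltW a0).
have : `|x + t *: e j| `^ p <= (a + s) `^ p.
  by rewrite ge0_ler_powR ?nnegrE ?(ltW p0) ?(ltW as0)//; move: h; rewrite -/a; lra.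
have : (p * (a + s) `^ (p - 1)) * s <= (p * (a + 1) `^ (p - 1)) * s.
  rewrite ler_wpM2r// ler_pM2l// ge0_ler_powR ?nnegrE ?(ltW as0)//; first lra.
    by rewrite addr_ge0 ?(ltW a0).
  by rewrite lerD2l.
have : (p * (a + 1) `^ (p - 1)) * s <= eps * t ^+ 2.
  rewrite /s mulrA ler_wpM2r ?sqr_ge0// -ler_pdivlMl// mulrC.
  by rewrite ge_min lexx orbT.
rewrite opprD addrA subrr sub0r mulrN; lra.
Qed.

(** By [powR_quadratic] the second difference dominates both that of the norm itself and the squared
    increment of the norm. Smallness makes both derivatives of the norm along the line vanish at 0,
    against clause (ii) along [0, 1] if the vectors meet. *)
Lemma second_difference_disjoint (x y : X) :
  small_square (second_difference p x y) ->
  forall j, coord x j = 0 \/ coord y j = 0.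
Proof.
move=> F; have [->|x0] := eqVneq x 0; first by move=> j; left; rewrite coord0.
have a0 : 0 < `|x| by rewrite normr_gt0.
set a := `|x| in a0 *.
set c := p / 2 * (a ^+ 2) `^ (p / 2 - 1).
have c0 : 0 < c by rewrite mulr_gt0 ?powR_gt0 ?exprn_gt0//; move: p2; lra.
have sum_ge (t : R) : 0 <= `|x + t *: y| + `|x - t *: y| - a *+ 2.
  rewrite subr_ge0 /a -normrMn.
  rewrite (_ : x *+ 2 = (x + t *: y) + (x - t *: y)) ?ler_normD//.
  by rewrite addrACA subrr addr0 mulr2n.
(* From b^2 - a^2 = 2 a (b - a) + (b - a)^2 for both norms b. *)
have key (t : R) : c * (a *+ 2 * (`|x + t *: y| + `|x - t *: y| - a *+ 2)
    + ((`|x + t *: y| - a) ^+ 2 + (`|x - t *: y| - a) ^+ 2))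
    <= second_difference p x y t.
  have := powR_quadratic p2 a0 (normr_ge0 (x + t *: y)).
  have := powR_quadratic p2 a0 (normr_ge0 (x - t *: y)).
  rewrite -/c /second_difference -/a !mulr2n.
  by move=> h1 h2; apply: le_trans (lerB (lerD h2 h1) (lexx _)); lra.
have F1 : small_square (fun t => `|x + t *: y| + `|x - t *: y| - a *+ 2).
  have ca0 : 0 < c * (a *+ 2) by rewrite mulr_gt0// mulrn_wgt0.
  apply: (small_square_le (c := (c * (a *+ 2))^-1)) F => [|t].
    by rewrite invr_gt0.
  rewrite ler_pdivlMl// (le_trans _ (key t))// [leRHS]mulrDr [X in _ <= X + _]mulrA lerDl.
  by rewrite mulr_ge0 ?(ltW c0)// addr_ge0 ?sqr_ge0.
have F2 : small_square (fun t => (`|x + t *: y| - a) ^+ 2).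
  apply: (small_square_le (c := c^-1)) F => [|t]; first by rewrite invr_gt0.
  rewrite ler_pdivlMl// (le_trans _ (key t))// ler_wpM2l ?(ltW c0)//.
  rewrite addrCA lerDl addr_ge0 ?sqr_ge0// mulr_ge0//.
  by rewrite mulrn_wge0// ltW.
(* For proportional vectors the norm grows linearly: at [t = k * r] its squared increment is
   [|y| ^+ 2 * t ^+ 2], which is not o(t^2). *)
have [[k xE]|nspan] := pselect (exists k : R, x = k *: y).
  exfalso.
  have k0 : k != 0 by apply: contra x0 => /eqP k0; rewrite xE k0 scale0r.
  have y0 : y != 0 by apply: contra x0 => /eqP y0; rewrite xE y0 scaler0.
  have ny : 0 < `|y| by rewrite normr_gt0.
  have nk : 0 < `|k| by rewrite normr_gt0.
  have e0 : 0 < `|y| ^+ 2 / 2 by rewrite divr_gt0// exprn_gt0.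
  have [d d0 H] := F2 _ e0.
  set r := d / (2 * `|k|).
  have r0 : 0 < r by rewrite divr_gt0// mulr_gt0.
  have rk : `|k * r| = d / 2.
    by rewrite normrM (gtr0_norm r0) /r; field; rewrite gt_eqF.
  have := H (k * r); rewrite rk => /(_ ltac:(lra)).
  have -> : `|x + (k * r) *: y| - a = r * `|k| * `|y|.
    have r1 : 0 < 1 + r by rewrite addr_gt0.
    rewrite /a xE -scalerDl !normrZ (_ : k + k * r = k * (1 + r)); last by ring.
    by rewrite normrM (gtr0_norm r1); ring.
  rewrite -[(k * r) ^+ 2]real_normK ?num_real// normrM (gtr0_norm r0).
  have : 0 < (`|k| * r) ^+ 2 * `|y| ^+ 2.
    by rewrite mulr_gt0// exprn_gt0// mulr_gt0.
  have -> : (r * `|k| * `|y|) ^+ 2 = (`|k| * r) ^+ 2 * `|y| ^+ 2 by ring.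
  have -> : `|y| ^+ 2 / 2 * (`|k| * r) ^+ 2 = (`|k| * r) ^+ 2 * `|y| ^+ 2 / 2.
    by ring.
  by lra.
have [N1 N2] : derive1 (fun t : R => `|x + t *: y|) 0 = 0 /\
    derive1 (derive1 (fun t : R => `|x + t *: y|)) 0 = 0.
  apply: second_difference_vanish.
  - exact: (@norm_line_derivable _ _ X_C2 _ _ nspan).
  - exact: (@norm_line_derivable2 _ _ X_C2 _ _ nspan _).
  - by move=> t; rewrite scale0r addr0 scaleNr; exact: sum_ge.
  - move=> eps eps0; have [d1 d10 H1] := F1 _ eps0.
    have [d2 d20 H2] := F2 _ eps0.
    exists (Num.min d1 d2); first by rewrite lt_min d10.
    move=> t; rewrite lt_min => /andP[/H1 h1 /H2 h2].
    by rewrite scale0r addr0 scaleNr.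
apply/(disjoint_inP e_basis e_signs); apply: contrapT => nd.
have [_ ii _] := X_reflects nspan.
apply: (ii nd N1 _ full_measure_01); apply: vanishes_along_01 => //.
- by move=> t; exact: (@norm_line_derivable2 _ _ X_C2 _ _ nspan t).
- exact: (@norm_line_continuous2 _ _ X_C2 _ _ nspan 0).
Qed.

End base_space.

(** * From components to l_p(X) *)

Section lp_second_order.
Context {R : realType} {p : R} {p1 : 1 <= p} {X : normedModType R}.
Local Notation L := (lp p1 X).
Implicit Types (z w : L).

Lemma lp_add_single_pow z k (u : X) (d : R) : 0 <= d ->
  `|z k + u| `^ p <= `|z k| `^ p + d ->
  `|z + lp_single p1 k u| `^ p <= `|z| `^ p + d.
Proof.
move=> d0 zk; apply: lp_norm_pow_le => n.
have h l : `|(z + lp_single p1 k u) l| `^ p <=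
    `|z l| `^ p + (if l == k then d else 0).
  rewrite lpD lp_singleE; case: eqVneq => [->//|_].
  by rewrite !addr0.
apply: le_trans (ler_sum _ (fun l _ => h l)) _.
rewrite big_split/= lerD ?lp_partial_sum_le//.
by rewrite -big_mkcond/= big_nat1_eq; case: ifP.
Qed.

(** All components have nonnegative second differences, so the one at [k] is at most their total. *)
Lemma second_difference_component z w k (t : R) : 1 < p ->
  second_difference p (z k) (w k) t <= second_difference p z w t.
Proof.
move=> p11; set F := second_difference p (z k) (w k) t.
have split n : (k < n)%N -> F + (\sum_(0 <= l < n) `|z l| `^ p) *+ 2 <=
    `|z + t *: w| `^ p + `|z - t *: w| `^ p.
  move=> kn; have h1 := lp_partial_sum_le (z + t *: w) n.
  have h2 := lp_partial_sum_le (z - t *: w) n.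
  apply: le_trans (lerD h1 h2); rewrite -big_split -lerBrDr -sumrMnl -sumrB.
  rewrite (bigD1_seq k) ?mem_index_iota ?iota_uniq//.
  by rewrite ler_wpDr// sumr_ge0// => l _; exact: second_difference_ge0.
rewrite /second_difference.
move: (`|z + t *: w| `^ p + `|z - t *: w| `^ p) split => T split.
suff : `|z| `^ p <= (T - F) / 2.
  by rewrite ler_pdivlMr// mulr_natr lerBrDr addrC -lerBrDr.
apply: lp_norm_pow_le => n.
have : \sum_(0 <= l < n) `|z l| `^ p <= \sum_(0 <= l < n + k.+1) `|z l| `^ p.
  rewrite [leRHS](big_cat_nat (n := n))/= ?leq_addr// lerDl.
  by rewrite sumr_ge0// => l _; rewrite powR_ge0.
(* The range is enlarged so that it contains [k]. *)
have := split (n + k.+1)%N; rewrite addnS ltnS leq_addl => /(_ isT).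
by rewrite mulr2n; lra.
Qed.

End lp_second_order.

(** * Contractive projections *)

Section contractive_projection_structure.
Context {R : realType} {I : countType} {Z : normedModType R}.
Variable e : I -> Z.
Hypothesis e_basis : one_unconditional_basis e.
Hypothesis e_signs : sign_changes e.
Local Notation coord := (Defs.coord e).
Local Notation restr := (restr e_signs).
Variable p : R.
Hypothesis p1 : 1 < p.

(** The geometry special to l_p(X) enters this section only through these two second order
    properties. *)
Hypothesis disjoint_small : forall z i, coord z i = 0 ->
  small_square (fun t => `|z + t *: e i| `^ p - `|z| `^ p).
Hypothesis small_disjoint : forall y w,
  small_square (second_difference p y w) ->
  forall i, coord y i = 0 \/ coord w i = 0.

Variable P : bop Z Z.
Hypothesis P_proj : contractive_projection P.

Let P_idem z : P (P z) = P z. Proof. exact: P_proj.1. Qed.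

Let P_le z : `|P z| <= `|z|.
Proof.
apply: le_trans (opnorm_ge P z) _.
by rewrite ler_piMl//; exact: P_proj.2.
Qed.

Let p0 : 0 < p. Proof. exact: lt_trans ltr01 p1. Qed.

(** Since [P] fixes [y] and is contractive, moving from [y] along [P (e i)] increases the norm no
    more than moving along [e i]. Adding the bounds at [t] and [- t] makes the second difference
    small. *)
Lemma contractive_projection_band y i k : P y = y ->
  coord y i = 0 -> coord y k != 0 -> coord (P (e i)) k = 0.
Proof.
move=> Py yi yk; suff H : small_square (second_difference p y (P (e i))).
  by have [yk0|//] := small_disjoint H k; rewrite yk0 eqxx in yk.
move=> eps eps0.
have [d d0 H] := disjoint_small yi (divr_gt0 eps0 (ltr0n R 2)).
have PH t : `|y + t *: P (e i)| `^ p <= `|y + t *: e i| `^ p.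
  rewrite -[X in `|X + _|]Py -bopZ -bopD.
  by rewrite ge0_ler_powR ?nnegrE ?(ltW p0)//; exact: P_le.
exists d => // t td; have := H t td.
have := H (- t); rewrite normrN sqrrN => /(_ td).
have := PH t; have := PH (- t).
by rewrite /second_difference -!scaleNr; lra.
Qed.

Lemma contractive_projection_off_support y b k : P y = y ->
  (forall i, coord y i = 0 \/ coord b i = 0) -> coord y k != 0 ->
  coord (P b) k = 0.
Proof.
move=> Py yb yk.
apply: (@eq0_le_eps R R^o 1) => eps eps0; rewrite mul1r.
have bE := coord_cvg_partial_sum e_basis (i := k)
  (bop_cvg_partial_sum (f := P) (coord_expansion e_basis (z := b))).
have [F FP] := (cvg_partial_sumP _ _).1 bE _ eps0.
have := FP F (fsubset_refl _); rewrite big1 ?subr0; first exact: ltW.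
move=> i _ /=; rewrite bopZ coordZ//.
have [yi|->] := yb i; last by rewrite mul0r.
by rewrite (contractive_projection_band Py yi yk) mulr0.
Qed.

(** Convexity gives the upper bound, restriction to the support of [a] the lower one. *)
Lemma norm_restr_add_eq a w : (forall i, coord a i = 0 \/ coord w i = 0) ->
  `|a + w| <= `|a| -> forall t, 0 <= t <= 1 -> `|a + t *: w| = `|a|.
Proof.
move=> aw awle t /andP[t0 t1]; apply/le_anti/andP; split.
  have -> : a + t *: w = (1 - t) *: a + t *: (a + w).
    by rewrite scalerDr addrA -scalerDl subrK scale1r.
  apply: le_trans (ler_normD _ _) _; rewrite !normrZ.
  rewrite (ger0_norm t0) ger0_norm ?subr_ge0//.
  have : t * `|a + w| <= t * `|a| by rewrite ler_wpM2l.
  by lra.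
have aE : restr (Defs.support e a) (a + t *: w) = a.
  apply: (coord_inj e_basis); apply/funext => i.
  rewrite coord_restr// coordD// coordZ//.
  have [wi|wi] := eqVneq (coord w i) 0; have [ai|ai] := eqVneq (coord a i) 0.
  - by rewrite ai wi mulr0 addr0; case: ifP.
  - by rewrite mem_set// wi mulr0 addr0.
  - by rewrite memNset// /Defs.support /= ai eqxx.
  - by case: (aw i) => /eqP; [rewrite (negPf ai)|rewrite (negPf wi)].
by rewrite -[X in `|X| <= _]aE; exact: norm_restr_le.
Qed.

(** The defect [w] of the restriction [a] is disjoint from [a], and [a + w], which is [P a], has
    norm at most that of [a]. So the norm is constant on the segment from [a] to [a + w]. At its
    midpoint the second difference along [w] vanishes, which makes the midpoint disjoint from [w]
    and forces [w = 0]. *)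
Lemma contractive_projection_restr y z : P y = y -> P z = z ->
  P (restr (Defs.support e y) z) = restr (Defs.support e y) z.
Proof.
move=> Py Pz; set a := restr _ z; set w := P a - a.
have ya i : coord y i = 0 -> coord a i = 0.
  by move=> yi; rewrite coord_restr// memNset// /Defs.support /= yi eqxx.
have yza i : coord y i = 0 \/ coord (z - a) i = 0.
  have [yi|yi] := eqVneq (coord y i) 0; [by left|right].
  by rewrite coordB// coord_restr// mem_set// subrr.
(* The part [z - a] vanishes on the support of [y], hence so does its image under [P]. *)
have wE : w = (z - a) - P (z - a).
  by rewrite /w bopB Pz opprB [RHS]addrC subrKA.
have wy i : coord y i != 0 -> coord w i = 0.
  move=> yi; rewrite wE coordB// (contractive_projection_off_support Py yza yi).
  by rewrite subr0; case: (yza i) => // yi0; rewrite yi0 eqxx in yi.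
have aw i : coord a i = 0 \/ coord w i = 0.
  by have [/ya|/wy] := eqVneq (coord y i) 0; [left|right].
have awle : `|a + w| <= `|a| by rewrite addrC subrK P_le.
have const := norm_restr_add_eq aw awle.
suff w0 : w = 0 by apply/eqP; rewrite -subr_eq0 -/w w0.
have H : small_square (second_difference p (a + 2^-1 *: w) w).
  (* Within 1/2 of the midpoint the parameter stays in [0, 1]. *)
  move=> eps eps0; exists 2^-1; first by rewrite invr_gt0.
  move=> t; rewrite ltr_norml => /andP[t1 t2].
  rewrite /second_difference -!addrA -scalerDl -scalerBl !const; first last.
  - by apply/andP; split; lra.
  - by apply/andP; split; lra.
  - by apply/andP; split; lra.
  by rewrite addrA -mulr2n subrr mulr_ge0 ?sqr_ge0// ltW.
apply: (coord_inj e_basis); apply/funext => i; rewrite coord0//.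
have [h|//] := small_disjoint H i; have [ai|//] := aw i.
by move: h; rewrite coordD// (coordZ e_basis _ w) ai add0r; lra.
Qed.

Lemma contractive_projection_averaging :
  averaging_operator e P /\ admits_block_basis e (range P).
Proof.
have [u uP] := blocks_ex e_basis contractive_projection_restr.
have u1 i := (uP i).1; have u2 i := (uP i).2.
split.
- exact: (projection_averaging e_basis P_idem contractive_projection_band
    contractive_projection_restr u1 u2).
- exact: (projection_block_basis e_basis P_idem contractive_projection_restr u1 u2).
Qed.

End contractive_projection_structure.

Theorem theorem4p3 (R : realType) (p : R) (p2 : 2 < p)
    (X : completeNormedModType R) (J : countType) (e : J -> X)
    (e_basis : one_unconditional_basis e)
    (X_C2 : C2_smooth X)
    (X_reflects : reflects_disjointness e)
    (X_bounded : norm_derivatives_bounded_on_sphere X)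
    (P : bop (lp (lt2_le1 p2) X) (lp (lt2_le1 p2) X))
    (P_proj : contractive_projection P) :
  averaging_operator (lp_basis (lt2_le1 p2) e) P /\
  admits_block_basis (lp_basis (lt2_le1 p2) e) (range P).
Proof.
have e_signs := complete_basis_signs e_basis.
have p1 : 1 < p by rewrite (lt_trans _ p2)// ltr1n.
have E_coord := coord_lp (p1 := lt2_le1 p2) e_basis e_signs.
apply: (contractive_projection_averaging
  (lp_basis_one_unconditional e_basis e_signs) (lp_basis_signs e_basis e_signs)
  p1 _ _ P_proj).
(* Adding a multiple of a basis vector changes component [k] only, so the bound in X carries
   over. *)
- move=> z [k j]; rewrite E_coord => zkj eps eps0.
  have [d d0 H] := norm_pow_add_disjoint_basis p2 e_basis e_signs X_C2 X_reflects
    zkj eps0.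
  exists d => // t /H; rewrite !lerBlDl => h.
  rewrite (_ : t *: lp_basis _ e (k, j) = lp_single (lt2_le1 p2) k (t *: e j)).
    by apply: lp_add_single_pow => //; rewrite mulr_ge0 ?sqr_ge0// ltW.
  apply: lp_ext => l; rewrite lpZ !lp_singleE /=.
  by case: ifP => // _; rewrite scaler0.
(* The second difference of component [k] is below the total one, so disjointness is decided in
   X. *)
- move=> y w H [k j]; rewrite !E_coord /=.
  apply: (second_difference_disjoint p2 e_basis e_signs X_C2 X_reflects).
  apply: (small_square_le (c := 1)) H => // t; rewrite mul1r.
  exact: second_difference_component.
Qed.
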